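(* For every entangled bipartite state $\rho$, $$\frac{E_D(\rho)}{E_c(\rho)}\le \mathcal S_E^{as}(\rho)\le 1,$$ equivalently $\dfrac{E_b(\rho)}{E_c(\rho)}\ge\mathcal A_E^{as}(\rho)$, where $E_b=E_c-E_D$. In particular, if $\mathcal A_E^{as}(\rho)>0$ then $E_D(\rho)<E_c(\rho)$.
   Context: $V$ is the swap of subsystems, $V(x\otimes y)=y\otimes x$. For bipartite states $\rho,\sigma$, the transition rate $R(\rho\to\sigma)$ is the supremum of all $r\ge0$ such that there exist LOCC operations $\Lambda_n$ and integers $m_n$ with $m_n/n\to r$ and $\|\Lambda_n(\rho^{\otimes n})-\sigma^{\otimes m_n}\|_1\to0$. The round-trip rate is $R(\rho\rightleftharpoons\sigma)=R(\rho\to\sigma)R(\sigma\to\rho)$ with $0\cdot\infty=\infty\cdot0=0$. The symmetry of entanglement is $\mathcal S_E^{as}(\rho)=R(\rho\to V\rho V^\dagger)$, which equals $\sup_\sigma R(\rho\rightleftharpoons\sigma)$ over all swap-invariant states $\sigma$ ($V\sigma V=\sigma$); the asymmetry of entanglement is $\mathcal A_E^{as}=1-\mathcal S_E^{as}$. With $\psi_+=\frac1{\sqrt2}(|00\rangle+|11\rangle)$, distillable entanglement is $E_D(\rho)=R(\rho\to\psi_+)$ and entanglement cost is $E_c(\rho)=1/R(\psi_+\to\rho)$; $E_c(\rho)>0$ for every entangled state $\rho$. *)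

(* Defs.v *)
From HB Require Import structures.
From mathcomp Require Import all_boot all_order all_algebra.
From mathcomp Require Import complex.
From mathcomp Require Import all_classical all_reals all_analysis.
Set Implicit Arguments. Unset Printing Implicit Defensive.
Import Order.TTheory GRing.Theory Num.Theory.
Import numFieldNormedType.Exports.
Local Open Scope classical_set_scope.
Local Open Scope ring_scope.

Section Quantum.
Variable R : realType.
Local Notation C := R[i].

(** Matrices with rows indexed by the finite type T and columns by U
    (i.e. linear maps C^U -> C^T in the computational bases). *)
Definition mat (T U : finType) := T -> U -> C.

Definition mulm (T U V : finType) (X : mat T U) (Y : mat U V) : mat T V :=
  fun i k => \sum_(j : U) X i j * Y j k.
Definition adjm (T U : finType) (X : mat T U) : mat U T :=
  fun j i => conjc (X i j).
Definition idm (T : finType) : mat T T := fun i j => (i == j)%:R.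
Definition subm (T U : finType) (X Y : mat T U) : mat T U :=
  fun i j => X i j - Y i j.
Definition trm (T : finType) (X : mat T T) : C := \sum_(i : T) X i i.
Definition kron (T U T' U' : finType) (X : mat T U) (Y : mat T' U')
  : mat (T * T')%type (U * U')%type := fun i j => X i.1 j.1 * Y i.2 j.2.
Definition sandw (T U : finType) (K : mat T U) (X : mat U U) : mat T T :=
  mulm (mulm K X) (adjm K).
Arguments mulm {T U V}.
Arguments adjm {T U}.
Arguments idm  T.
Arguments subm {T U}.
Arguments trm {T}.
Arguments kron {T U T' U'}.
Arguments sandw {T U}.

Definition psd (T : finType) (X : mat T T) : Prop :=
  forall v : T -> C, 0 <= \sum_(i : T) \sum_(j : T) conjc (v i) * X i j * v j.
Definition is_state (T : finType) (X : mat T T) : Prop := psd X /\ trm X = 1.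
Arguments psd {T}.
Arguments is_state {T}.

Definition unitary (T : finType) (U : mat T T) : Prop :=
  mulm (adjm U) U = @idm T.
Arguments unitary {T}.

(** Trace norm, through the variational formula ||X||_1 = sup_U |tr(U X)|
    over unitaries U. *)
Definition tnorm (T : finType) (X : mat T T) : R :=
  sup [set Normc.normc (trm (mulm U X)) | U in [set U | unitary U]].
Arguments tnorm {T}.

Definition tp_kraus (I T U : finType) (K : I -> mat T U) : Prop :=
  forall x y, \sum_(k : I) mulm (adjm (K k)) (K k) x y = @idm U x y.
Arguments tp_kraus {I T U}.

Definition bop (A B : finType) := mat (A * B)%type (A * B)%type.

(** Finite-round LOCC channels from the bipartite system A:B to A':B'.
    - local: a product of local channels (given by Kraus families)
    - Alice (resp. Bob) performs an instrument with outcomes I (each outcome i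
      with Kraus operators K i j, j : J), broadcasts the outcome, and the
      protocol continues with an LOCC channel Psi i depending on i. *)
Inductive LOCC : forall (A B A' B' : finType), (bop A B -> bop A' B') -> Prop :=
| LOCC_local (A B A' B' I J : finType) (K : I -> mat A' A) (L : J -> mat B' B) :
    tp_kraus K -> tp_kraus L ->
    LOCC (fun X => fun x y =>
            \sum_(i : I) \sum_(j : J) sandw (kron (K i) (L j)) X x y)
| LOCC_Alice (A B A'' A' B' I J : finType) (K : I -> J -> mat A'' A)
    (Psi : I -> bop A'' B -> bop A' B') :
    tp_kraus (fun ij : (I * J)%type => K ij.1 ij.2) ->
    (forall i, LOCC (Psi i)) ->
    LOCC (fun X => fun x y =>
            \sum_(i : I) Psi i (fun u v =>
               \sum_(j : J) sandw (kron (K i j) (@idm B)) X u v) x y)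
| LOCC_Bob (A B B'' A' B' I J : finType) (L : I -> J -> mat B'' B)
    (Psi : I -> bop A B'' -> bop A' B') :
    tp_kraus (fun ij : (I * J)%type => L ij.1 ij.2) ->
    (forall i, LOCC (Psi i)) ->
    LOCC (fun X => fun x y =>
            \sum_(i : I) Psi i (fun u v =>
               \sum_(j : J) sandw (kron (@idm A) (L i j)) X u v) x y).

Definition tpow (A B : finType) (rho : bop A B) (n : nat)
  : bop {ffun 'I_n -> A} {ffun 'I_n -> B} :=
  fun x y => \prod_(k < n) rho (x.1 k, x.2 k) (y.1 k, y.2 k).
Arguments tpow {A B}.

Definition achievable (A B A' B' : finType) (rho : bop A B) (sigma : bop A' B')
  (r : R) : Prop :=
  0 <= r /\
  exists (m : nat -> nat)
    (Lam : forall n, bop {ffun 'I_n -> A} {ffun 'I_n -> B} ->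
                     bop {ffun 'I_(m n) -> A'} {ffun 'I_(m n) -> B'}),
    (forall n, LOCC (Lam n)) /\
    ((fun n => (m n)%:R / n%:R : R) @ \oo --> r) /\
    ((fun n => tnorm (subm (Lam n (tpow rho n)) (tpow sigma (m n)))) @ \oo
       --> (0 : R)).
Arguments achievable {A B A' B'}.

Definition rate (A B A' B' : finType) (rho : bop A B) (sigma : bop A' B')
  : \bar R := ereal_sup [set r%:E | r in achievable rho sigma].
Arguments rate {A B A' B'}.

Definition swapop (A B : finType) (rho : bop A B) : bop B A :=
  fun x y => rho (x.2, x.1) (y.2, y.1).
Arguments swapop {A B}.

Definition psi_plus : bop 'I_2 'I_2 :=
  fun x y => if (x.1 == x.2) && (y.1 == y.2) then 2^-1 else 0.
Arguments psi_plus .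

Definition E_D (A B : finType) (rho : bop A B) : \bar R := rate rho psi_plus.
Definition E_c (A B : finType) (rho : bop A B) : \bar R :=
  ((rate psi_plus rho)^-1)%E.
Definition E_b (A B : finType) (rho : bop A B) : \bar R :=
  (E_c rho - E_D rho)%E.
Definition sym_ent (A B : finType) (rho : bop A B) : \bar R :=
  rate rho (swapop rho).
Definition asym_ent (A B : finType) (rho : bop A B) : \bar R :=
  (1 - sym_ent rho)%E.
Arguments E_D {A B}.
Arguments E_c {A B}.
Arguments E_b {A B}.
Arguments sym_ent {A B}.
Arguments asym_ent {A B}.

Definition separable (A B : finType) (rho : bop A B) : Prop :=
  exists (k : nat) (p : 'I_k -> R) (alpha : 'I_k -> mat A A)
         (beta : 'I_k -> mat B B),
    (forall i, 0 <= p i) /\ \sum_(i < k) p i = 1 /\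
    (forall i, is_state (alpha i) /\ is_state (beta i)) /\
    forall x y, rho x y = \sum_(i < k) Complex (p i) 0 * kron (alpha i) (beta i) x y.
Arguments separable {A B}.

Definition entangled (A B : finType) (rho : bop A B) : Prop :=
  is_state rho /\ ~ separable rho.
Arguments entangled {A B}.

End Quantum.

Arguments mulm {R T U V}.
Arguments adjm {R T U}.
Arguments idm {R} T.
Arguments subm {R T U}.
Arguments trm {R T}.
Arguments kron {R T U T' U'}.
Arguments sandw {R T U}.
Arguments psd {R T}.
Arguments is_state {R T}.
Arguments unitary {R T}.
Arguments tnorm {R T}.
Arguments tp_kraus {R I T U}.
Arguments tpow {R A B}.
Arguments achievable {R A B A' B'}.
Arguments rate {R A B A' B'}.
Arguments swapop {R A B}.
Arguments psi_plus {R}.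
Arguments E_D {R A B}.
Arguments E_c {R A B}.
Arguments E_b {R A B}.
Arguments sym_ent {R A B}.
Arguments asym_ent {R A B}.
Arguments separable {R A B}.
Arguments entangled {R A B}.

(* Main.v *)
Require Import Defs.
From HB Require Import structures.
From mathcomp Require Import all_boot all_order all_algebra.
From mathcomp Require Import spectral complex.
From mathcomp Require Import all_classical all_reals all_analysis.
From mathcomp Require Import ring lra.

(** Rates multiply along a chain of transformations, and the maximally entangled
    state psi_+ is invariant under the swap. Hence
    R(rho -> psi) R(psi -> rho) <= R(rho -> V rho V) and
    R(psi -> rho) R(rho -> V rho V) <= R(psi -> rho), which gives everything once
    0 < R(psi -> rho) < +oo. Positivity is teleportation.

    Finiteness says that entangled states have positive cost. An entangled rho is
    separated from the separable states by a local measurement: there is a weight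
    g > 0 on the outcomes whose mean is at most 1 on every product vector, while
    the mean of 1 / g on rho is some a < 1. On m copies the test
    "the product of the weights is at least t ^ m", with 1 < t < 1 / a, accepts
    rho with probability at least 1 - (t a) ^ m. A product vector passes with
    probability at most t ^ -m, because measuring one copy of a product vector
    leaves a product vector, so any state obtained from n copies of psi by LOCC
    passes with probability at most 2 ^ n t ^ -m. *)

Set Implicit Arguments. Unset Strict Implicit. Unset Printing Implicit Defensive.
Import Order.TTheory GRing.Theory Num.Theory.
Import numFieldNormedType.Exports.
Local Open Scope classical_set_scope.
Local Open Scope ring_scope.
Local Open Scope complex_scope.
Local Notation Re := complex.Re.
Local Notation Im := complex.Im.

(** * Complex numbers and matrices *)

Section ComplexNumbers.
Variable R : realType.
Local Notation C := R[i].
Implicit Types z : C.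

(** The obstacle is tensorisation. A vector that is a product between Alice and Bob may still be
    entangled among the copies held by one party, so a linear witness for one copy does not control
    [m] copies; a non-negative weight does, since bounds can then be inserted copy by copy under the
    sum.

    The weight comes from convex geometry. Under an informationally complete product measurement the
    outcome distributions of mixtures of product vectors form a compact convex set, and the
    distribution of [rho] lies outside it. The nearest point yields [w] with mean at most 0 on
    product vectors and mean d > 0 on [rho]. Then g = 1 + eps w has mean at most 1 on the former,
    while 1 / g has mean 1 - eps d + O(eps^2) on [rho]. Both error probabilities of the test are
    instances of Markov's inequality: for the product of the weights on product vectors, and for the
    product of the inverse weights on [rho], whose mean factorises exactly because the copies are
    independent. *)

Definition sqn z : R := Re z ^+ 2 + Im z ^+ 2.

Lemma conjcM z z' : conjc (z * z') = conjc z * conjc z'.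
Proof. exact: rmorphM. Qed.

Lemma conjcD z z' : conjc (z + z') = conjc z + conjc z'.
Proof. exact: rmorphD. Qed.

Lemma sqn_ge0 z : 0 <= sqn z.
Proof. by rewrite addr_ge0 ?sqr_ge0. Qed.

Lemma mulcJ z : z * conjc z = (sqn z)%:C.
Proof. by case: z => a b; rewrite /sqn /=; simpc; congr Complex; ring. Qed.

Lemma mulJc z : conjc z * z = (sqn z)%:C.
Proof. by rewrite mulrC mulcJ. Qed.

Lemma sqnM z z' : sqn (z * z') = sqn z * sqn z'.
Proof. by apply: complexI; rewrite rmorphM/= -!mulcJ rmorphM /=; ring. Qed.

Lemma sqnJ z : sqn (conjc z) = sqn z.
Proof. by apply: complexI; rewrite -!mulcJ conjcK mulrC. Qed.

Lemma sqn0 : sqn 0 = 0.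
Proof. by rewrite /sqn expr0n /= addr0. Qed.

Lemma sqn1 : sqn 1 = 1.
Proof. by apply: complexI; rewrite -mulcJ rmorph1 mulr1. Qed.

Lemma sqn_eq0 z : sqn z = 0 -> z = 0.
Proof.
move=> h; apply/eqP; rewrite -[_ == 0]orbb -{2}(conjc_eq0 z) -mulf_eq0 mulcJ h.
by rewrite rmorph0.
Qed.

Lemma sqn_real (x : R) : sqn x%:C = x ^+ 2.
Proof. by rewrite /sqn /= expr0n /= addr0. Qed.

Lemma ReD z z' : Re (z + z') = Re z + Re z'.
Proof. by case: z => a b; case: z'. Qed.

Lemma ImD z z' : Im (z + z') = Im z + Im z'.
Proof. by case: z => a b; case: z'. Qed.

Lemma ReN z : Re (- z) = - Re z.
Proof. by case: z. Qed.

Lemma Re_sum (I : Type) (s : seq I) (P : pred I) (F : I -> C) :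
  Re (\sum_(i <- s | P i) F i) = \sum_(i <- s | P i) Re (F i).
Proof. exact: (big_morph _ ReD). Qed.

Lemma Im_sum (I : Type) (s : seq I) (P : pred I) (F : I -> C) :
  Im (\sum_(i <- s | P i) F i) = \sum_(i <- s | P i) Im (F i).
Proof. exact: (big_morph _ ImD). Qed.

Lemma normcE z : Normc.normc z = Num.sqrt (sqn z).
Proof. by case: z. Qed.

Lemma normc_ge0 z : 0 <= Normc.normc z.
Proof. by rewrite normcE sqrtr_ge0. Qed.

Lemma sqr_normc z : Normc.normc z ^+ 2 = sqn z.
Proof. by rewrite normcE sqr_sqrtr ?sqn_ge0. Qed.

Lemma normc_real (x : R) : Normc.normc x%:C = `|x|.
Proof. by rewrite normcE sqn_real sqrtr_sqr. Qed.

Lemma normc_triangle z z' :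
  Normc.normc (z + z') <= Normc.normc z + Normc.normc z'.
Proof. exact: le_normcD. Qed.

Lemma normc_sum (I : Type) (s : seq I) (P : pred I) (F : I -> C) :
  Normc.normc (\sum_(i <- s | P i) F i)
  <= \sum_(i <- s | P i) Normc.normc (F i).
Proof.
elim/big_rec2: _ => [|i x z _ h]; first by rewrite Normc.normc0.
by rewrite (le_trans (normc_triangle _ _))// lerD2l.
Qed.

Lemma Re_le_normc z : `|Re z| <= Normc.normc z.
Proof.
rewrite normcE -(sqrtr_sqr (Re z)) ler_wsqrtr// /sqn lerDl sqr_ge0 //.
Qed.

Lemma normcM_le z z' :
  Normc.normc (z * z') <= (sqn z + sqn z') / 2.
Proof.
rewrite Normc.normcM -!sqr_normc.
have := sqr_ge0 (Normc.normc z - Normc.normc z'); lra.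
Qed.

(** Cauchy-Schwarz against the all-ones vector, with each cross term bounded by the mean of two
    squares. The cardinality is the origin of the factor 2 ^ n gained by [n] copies of
    [psi_plus]. *)
Lemma sqn_sum_le (I : finType) (F : I -> C) :
  sqn (\sum_i F i) <= #|I|%:R * \sum_i sqn (F i).
Proof.
rewrite -sqr_normc; apply: (@le_trans _ _ ((\sum_i Normc.normc (F i)) ^+ 2)).
  by rewrite lerXn2r ?nnegrE ?normc_ge0 ?normc_sum// sumr_ge0// => i _; rewrite normc_ge0.
rewrite expr2 mulr_suml.
under eq_bigr do rewrite mulr_sumr.
apply: (@le_trans _ _ (\sum_i \sum_j (sqn (F i) + sqn (F j)) / 2)).
  by apply: ler_sum => i _; apply: ler_sum => j _; rewrite -Normc.normcM normcM_le.
rewrite le_eqVlt; apply/orP; left; apply/eqP.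
transitivity (\sum_i \sum_(j : I) (sqn (F i) / 2)
   + \sum_(i : I) \sum_j (sqn (F j) / 2)).
  rewrite -big_split; apply: eq_bigr => i _ /=; rewrite -big_split.
  by apply: eq_bigr => j _ /=; rewrite mulrDl.
rewrite [X in _ + X]exchange_big -big_split mulr_sumr /=; apply: eq_bigr => i _.
by rewrite sumr_const -mulrnDl -splitr mulr_natl.
Qed.

End ComplexNumbers.

(** * Quadratic forms, squared norms and Hermitian matrices *)

Section Vectors.
Variable R : realType.
Local Notation C := R[i].
Local Notation mat := (mat R).

Definition nrm (T : finType) (w : T -> C) : R := \sum_i sqn (w i).

Definition qf (T : finType) (X : mat T T) (w : T -> C) : C :=
  \sum_i \sum_j conjc (w i) * X i j * w j.

Definition app (T U : finType) (K : mat T U) (w : U -> C) : T -> C :=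
  fun x => \sum_i K x i * w i.

Definition herm (T : finType) (X : mat T T) := forall i j, conjc (X j i) = X i j.

Lemma nrm_ge0 (T : finType) (w : T -> C) : 0 <= nrm w.
Proof. by rewrite sumr_ge0// => i _; rewrite sqn_ge0. Qed.

Lemma nrmE (T : finType) (w : T -> C) : (nrm w)%:C = \sum_i w i * conjc (w i).
Proof. by rewrite rmorph_sum; apply: eq_bigr => i _; rewrite mulcJ. Qed.

Lemma trm1_inhabited (T : finType) (X : mat T T) : trm X = 1 -> inhabited T.
Proof.
move=> X1; suff /card_gt0P[x _] : (0 < #|T|)%N by exists.
rewrite lt0n; apply/eqP => h; have := X1; rewrite /trm big_pred0.
  by move/eqP; rewrite eq_sym oner_eq0.
by move=> x; have := fintype0 x; rewrite h => /(_ erefl).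
Qed.

Lemma trm_mulm (T U : finType) (M : mat T U) (X : mat U T) :
  trm (mulm M X) = \sum_i \sum_j M i j * X j i.
Proof. by []. Qed.

Lemma sandwE (T U : finType) (K : mat T U) (X : mat U U) x y :
  sandw K X x y = \sum_i \sum_j K x i * X i j * conjc (K y j).
Proof.
rewrite /sandw /mulm /adjm exchange_big; apply: eq_bigr => j _ /=.
by rewrite mulr_suml.
Qed.

Lemma eq_qf (T : finType) (X Y : mat T T) w :
  (forall i j, X i j = Y i j) -> qf X w = qf Y w.
Proof.
by move=> h; apply: eq_bigr => i _; apply: eq_bigr => j _; rewrite h.
Qed.

Lemma qf_sum (T : finType) (I : Type) (s : seq I) (P : pred I) (X : I -> mat T T) w :
  qf (fun i j => \sum_(k <- s | P k) X k i j) w = \sum_(k <- s | P k) qf (X k) w.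
Proof.
rewrite /qf [RHS]exchange_big; apply: eq_bigr => i _ /=.
rewrite [RHS]exchange_big; apply: eq_bigr => j _ /=.
by rewrite mulr_sumr mulr_suml.
Qed.

Lemma qf_subm (T : finType) (X Y : mat T T) w :
  qf (subm X Y) w = qf X w - qf Y w.
Proof.
rewrite /qf -sumrB; apply: eq_bigr => i _; rewrite -sumrB.
by apply: eq_bigr => j _; rewrite /subm; ring.
Qed.

Lemma qf_sandw (T U : finType) (K : mat T U) (X : mat U U) w :
  qf (sandw K X) w = qf X (app (adjm K) w).
Proof.
rewrite /qf.
under eq_bigr => x _ do under eq_bigr => y _ do
  rewrite sandwE mulr_sumr mulr_suml.
under eq_bigr => x _ do rewrite exchange_big.
rewrite exchange_big; apply: eq_bigr => i _ /=.
under eq_bigr => x _ do under eq_bigr => y _ do rewrite mulr_sumr mulr_suml.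
under eq_bigr => x _ do rewrite exchange_big.
rewrite exchange_big; apply: eq_bigr => j _ /=.
rewrite /app rmorph_sum mulr_suml mulr_suml; apply: eq_bigr => x _ /=.
rewrite mulr_sumr; apply: eq_bigr => y _.
by rewrite /adjm rmorphM /= conjcK; ring.
Qed.

(** Cyclicity of the trace: conjugation by the adjoint is the dual map, which moves a channel from
    the state to the observable. *)
Lemma trm_sandw (T U : finType) (M : mat T T) (K : mat T U) (X : mat U U) :
  trm (mulm M (sandw K X)) = trm (mulm (sandw (adjm K) M) X).
Proof.
rewrite !trm_mulm.
under eq_bigr => x _ do under eq_bigr => y _ do rewrite sandwE mulr_sumr.
under [RHS]eq_bigr => x _ do under eq_bigr => y _ do rewrite sandwE mulr_suml.
transitivity (\sum_x \sum_y \sum_i \sum_j M x y * (K y i * X i j * conjc (K x j))).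
  by apply: eq_bigr => x _; apply: eq_bigr => y _; apply: eq_bigr => i _; rewrite mulr_sumr.
transitivity (\sum_j \sum_i \sum_x \sum_y
   (conjc (K x j) * M x y * K y i * X i j)); last first.
  apply: eq_bigr => j _; apply: eq_bigr => i _; apply: eq_bigr => x _.
  by rewrite mulr_suml; apply: eq_bigr => y _; rewrite /adjm conjcK.
rewrite exchange_big [RHS]exchange_big /=.
under eq_bigr => y _ do rewrite exchange_big /=.
rewrite exchange_big /=; apply: eq_bigr => i _.
under eq_bigr => y _ do rewrite exchange_big /=.
rewrite exchange_big /=; apply: eq_bigr => j _.
rewrite exchange_big /=; apply: eq_bigr => x _; apply: eq_bigr => y _; ring.
Qed.

Lemma trm_mulm_sum (T : finType) (I : Type) (s : seq I) (M : mat T T) (X : I -> mat T T) :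
  trm (mulm M (fun i j => \sum_(k <- s) X k i j)) = \sum_(k <- s) trm (mulm M (X k)).
Proof.
rewrite trm_mulm [RHS]exchange_big; apply: eq_bigr => i _ /=.
by rewrite [RHS]exchange_big; apply: eq_bigr => j _ /=; rewrite mulr_sumr.
Qed.

Lemma trm_mulmC (T U : finType) (M : mat T U) (X : mat U T) :
  trm (mulm M X) = trm (mulm X M).
Proof.
by rewrite !trm_mulm exchange_big; do 2 apply: eq_bigr => ? _; rewrite mulrC.
Qed.

Lemma herm_subm (T : finType) (X Y : mat T T) : herm X -> herm Y -> herm (subm X Y).
Proof. by move=> hX hY i j; rewrite /subm rmorphB /= hX hY. Qed.

Lemma herm_sandw (T U : finType) (K : mat T U) (X : mat U U) : herm X -> herm (sandw K X).
Proof.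
move=> hX x y; rewrite !sandwE exchange_big rmorph_sum; apply: eq_bigr => i _ /=.
rewrite rmorph_sum; apply: eq_bigr => j _ /=.
by rewrite !rmorphM /= conjcK hX; ring.
Qed.

Lemma herm_sum (T : finType) (I : Type) (s : seq I) (X : I -> mat T T) :
  (forall k, herm (X k)) -> herm (fun i j => \sum_(k <- s) X k i j).
Proof. by move=> hX i j; rewrite rmorph_sum; apply: eq_bigr => k _; apply: hX. Qed.

Lemma qf_add_delta (T : finType) (X : mat T T) (c : C) i j : i != j ->
  qf X (fun k => (k == i)%:R + c * (k == j)%:R)
  = X i i + c * X i j + conjc c * X j i + conjc c * c * X j j.
Proof.
move=> ij.
have e F : \sum_(k : T) F k * ((k == i)%:R + c * (k == j)%:R) = F i + c * F j.
  under eq_bigr do rewrite mulrDr.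
  rewrite big_split /= (bigD1 i) //= big1 ?eqxx; last by move=> k /negPf ->; rewrite mulr0.
  rewrite (bigD1 j) //= big1 ?eqxx; last by move=> k /negPf ->; rewrite !mulr0.
  by rewrite !mulr1n; ring.
rewrite /qf; under eq_bigr do rewrite e.
(* Conjugating the whole sum turns the remaining row index into the unconjugated vector, so that [e]
   applies a second time. *)
transitivity (conjc (\sum_k conjc (X k i + c * X k j) *
   ((k == i)%:R + c * (k == j)%:R))).
  rewrite rmorph_sum; apply: eq_bigr => k _; rewrite rmorphM /= conjcK; ring.
by rewrite e !(rmorphD,rmorphM) /= !conjcK; ring.
Qed.

(** A form with real values on e_i has a real diagonal. Its values on e_i + e_j and on e_i + 'i e_j
    then fix the imaginary and the real part of X_ji in terms of X_ij. *)
Lemma psd_herm (T : finType) (X : mat T T) : psd X -> herm X.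
Proof.
move=> hX.
have diag i : Im (X i i) = 0.
  have := ger0_Im (hX (fun k => (k == i)%:R)).
  rewrite (bigD1 i) //= [X in _ + X]big1 => [|k /negPf ->]; last first.
    by rewrite big1 // => l _; rewrite rmorph0 !mul0r.
  rewrite (bigD1 i) //= big1 => [|k /negPf ->]; last by rewrite mulr0.
  by rewrite eqxx rmorph1 mul1r mulr1 !addr0.
move=> i j; have [->|ij] := eqVneq i j.
  by case: (X j j) (diag j) => a b /= ->; rewrite oppr0.
have h1 := ger0_Im (hX (fun k => (k == i)%:R + 1 * (k == j)%:R)).
have h2 := ger0_Im (hX (fun k => (k == i)%:R + 'i * (k == j)%:R)).
move: h1 h2; rewrite -!/(qf _ _) !qf_add_delta//.
case: (X i j) (X j i) (X i i) (diag i) (X j j) (diag j) => [a b] [c d] [e f] /= -> [g h] /= ->.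
move=> h1 h2.
by congr Complex; lra.
Qed.

End Vectors.

(** * The trace norm of Hermitian matrices *)

Section TraceNorm.
Variable R : realType.
Local Notation C := R[i].
Local Notation mat := (mat R).

Lemma conjC_conjc (z : C) : z^*%R = conjc z.
Proof. by []. Qed.

Lemma spectral_decomposition (T : finType) (X : mat T T) : herm X ->
  exists (W : mat T T) (d : T -> R),
    [/\ forall k l, \sum_i conjc (W i k) * W i l = (k == l)%:R,
        forall i j, \sum_k W i k * conjc (W j k) = (i == j)%:R
      & forall i j, X i j = \sum_k (d k)%:C * W i k * conjc (W j k)].
Proof.
move=> hX; pose A : 'M[C]_#|T| := \matrix_(i, j) X (enum_val i) (enum_val j).
have hA : A \is hermsymmx.
  apply/is_hermitianmxP; rewrite expr0 scale1r.
  by apply/matrixP => i j; rewrite !mxE conjC_conjc hX.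
have hN := hermitian_normalmx hA.
have hP := spectral_unitarymx A.
have hD := hermitian_spectral_diag_real hA.
move/orthomx_spectralP: hN; rewrite invmx_unitary//.
set P := spectralmx A in hP *; set D := spectral_diag A in hD * => eA.
have PPt := unitarymxP hP.
have PtP := mulmx1C PPt.
have re (F : 'I_#|T| -> C) : \sum_i F i = \sum_(x : T) F (enum_rank x).
  by rewrite (reindex (@enum_rank T)) //; exact: onW_bij (enum_rank_bij T).
exists (fun i k => conjc (P (enum_rank k) (enum_rank i))).
exists (fun k => Re (D 0 (enum_rank k))); split.
- move=> k l; have /matrixP/(_ (enum_rank k) (enum_rank l)) := PPt.
  rewrite !mxE re (inj_eq enum_rank_inj) => <-; apply: eq_bigr => i _.
  by rewrite !mxE conjcK.
- move=> i j; have /matrixP/(_ (enum_rank i) (enum_rank j)) := PtP.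
  rewrite !mxE re (inj_eq enum_rank_inj) => <-; apply: eq_bigr => k _.
  by rewrite !mxE conjcK.
- move=> i j; have /matrixP/(_ (enum_rank i) (enum_rank j)) := eA.
  rewrite !mxE !enum_rankK re => ->; apply: eq_bigr => k _.
  rewrite conjcK mul_mx_diag !mxE RRe_real; first by rewrite conjC_conjc; ring.
  by have /mxOverP := hD; apply.
Qed.

Definition specmx (T : finType) (W : mat T T) (d : T -> R) : mat T T :=
  fun i j => \sum_k (d k)%:C * W i k * conjc (W j k).

Lemma qf_specmx (T : finType) (W : mat T T) d w :
  qf (specmx W d) w = \sum_k (d k * sqn (\sum_i conjc (w i) * W i k))%:C.
Proof.
rewrite /specmx qf_sum; apply: eq_bigr => k _; rewrite /qf rmorphM /= -mulcJ.
rewrite rmorph_sum big_distrl big_distrr /=; apply: eq_bigr => i _ /=.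
rewrite 2!big_distrr; apply: eq_bigr => j _ /=.
by rewrite rmorphM /= conjcK; ring.
Qed.

Lemma trm_specmx (T : finType) (M W : mat T T) d :
  trm (mulm M (specmx W d)) = \sum_k (d k)%:C * qf M (W ^~ k).
Proof.
rewrite /specmx trm_mulm_sum; apply: eq_bigr => k _.
rewrite /qf trm_mulm mulr_sumr; apply: eq_bigr => i _; rewrite mulr_sumr.
by apply: eq_bigr => j _; ring.
Qed.

(* Numerical radius at most one: this is all the trace norm duality needs,
   and unlike unitarity it passes to the adjoint of a channel. *)
Definition numcontr (T : finType) (M : mat T T) :=
  forall w, Normc.normc (qf M w) <= nrm w.

Lemma qf_app (T : finType) (U : mat T T) w :
  qf U w = \sum_i conjc (w i) * app U w i.
Proof.
by apply: eq_bigr => i _; rewrite mulr_sumr; apply: eq_bigr => j _; rewrite mulrA.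
Qed.

Lemma nrm_app (T U : finType) (K : mat T U) w :
  (nrm (app K w))%:C = qf (mulm (adjm K) K) w.
Proof.
rewrite nrmE /mulm qf_sum; apply: eq_bigr => x _; rewrite mulrC rmorph_sum.
rewrite /qf mulr_suml; apply: eq_bigr => i _; rewrite mulr_sumr.
by apply: eq_bigr => j _; rewrite /adjm rmorphM /=; ring.
Qed.

Lemma qf_idm (T : finType) (w : T -> C) : qf (idm T) w = (nrm w)%:C.
Proof.
rewrite nrmE; apply: eq_bigr => i _; rewrite (bigD1 i) //= /idm eqxx big1 => [|j].
  by rewrite mulr1 addr0 mulrC.
by rewrite eq_sym => /negPf ->; rewrite mulr0 mul0r.
Qed.

(** Each term of <w, U w> is at most the mean of |w_i|^2 and |(U w)_i|^2, and [U] preserves the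
    norm. *)
Lemma unitary_numcontr (T : finType) (U : mat T T) : unitary U -> numcontr U.
Proof.
move=> hU w; have h : nrm (app U w) = nrm w.
  by apply: complexI; rewrite nrm_app hU qf_idm.
rewrite qf_app (le_trans (normc_sum _ _ _))//.
apply: (@le_trans _ _ (\sum_i (sqn (w i) + sqn (app U w i)) / 2)).
  by apply: ler_sum => i _; rewrite -(sqnJ (w i)) normcM_le.
by rewrite -mulr_suml big_split /= -!/(nrm _) h; lra.
Qed.

Lemma unitary_idm (T : finType) : unitary (@idm R T).
Proof.
apply/funext => i; apply/funext => j; rewrite /mulm /adjm /idm (bigD1 i) //=.
rewrite eqxx rmorph1 mul1r big1 ?addr0// => k /negPf ->.
by rewrite rmorph0 mul0r.
Qed.

(** In an eigenbasis w_k of [X], tr(M X) is the sum of d_k <w_k, M w_k>, which is at most the sum of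
    |d_k| in modulus. The matrix with the signs of the d_k as eigenvalues is unitary and attains
    this. *)
Lemma herm_trace_norm_attained (T : finType) (X : mat T T) : herm X ->
  exists2 U, unitary U & forall M, numcontr M ->
    Normc.normc (trm (mulm M X)) <= Normc.normc (trm (mulm U X)).
Proof.
move=> /spectral_decomposition[W [d [WtW WWt eX]]].
have {eX} -> : X = specmx W d by apply/funext => i; apply/funext => j; exact: eX.
(* A zero eigenvalue gets sign 1 rather than 0, which keeps the sign matrix unitary. *)
pose s k : R := if 0 <= d k then 1 else -1.
have ss k : s k * s k = 1 by rewrite /s; case: ifP => _; ring.
have ds k : d k * s k = `|d k|.
  rewrite /s; case: ifP => h; first by rewrite ger0_norm// mulr1.
  by rewrite ler0_norm ?mulrN1// ltW// ltNge h.
have nW k : nrm (W ^~ k) = 1.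
  apply: complexI; rewrite nrmE.
  transitivity (\sum_i conjc (W i k) * W i k); last by rewrite WtW eqxx.
  by apply: eq_bigr => i _; rewrite mulrC.
exists (specmx W s).
  apply/funext => i; apply/funext => j; rewrite /mulm /adjm /specmx.
  transitivity (\sum_k \sum_l (s k * s l)%:C * (W i k * conjc (W j l)) *
     (\sum_x conjc (W x k) * W x l)).
    under [RHS]eq_bigr => k _ do under eq_bigr => l _ do rewrite mulr_sumr.
    under [RHS]eq_bigr => k _ do rewrite exchange_big.
    rewrite [RHS]exchange_big; apply: eq_bigr => x _ /=.
    rewrite rmorph_sum mulr_suml; apply: eq_bigr => k _ /=.
    rewrite mulr_sumr; apply: eq_bigr => l _ /=.
    rewrite !rmorphM /= conjcK oppr0 !complexr0; ring.
  rewrite /idm -WWt; apply: eq_bigr => k _; rewrite (bigD1 k) //= WtW eqxx.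
  rewrite ss big1 ?addr0 ?mulr1n => [|l]; first by ring.
  by rewrite WtW eq_sym => /negPf ->; rewrite mulr0.
move=> M hM; rewrite !trm_specmx.
have -> : \sum_k (d k)%:C * qf (specmx W s) (W^~ k) = (\sum_k `|d k|)%:C.
  rewrite rmorph_sum; apply: eq_bigr => k _; rewrite -ds rmorphM /=; congr (_ * _).
  rewrite qf_specmx (bigD1 k) //= WtW eqxx sqn1 mulr1 big1 ?addr0// => l.
  by rewrite WtW eq_sym => /negPf ->; rewrite sqn0 mulr0.
rewrite normc_real ger0_norm ?sumr_ge0//.
rewrite (le_trans (normc_sum _ _ _))//; apply: ler_sum => k _.
rewrite Normc.normcM normc_real ler_piMr// (le_trans (hM _))//.
by rewrite nW.
Qed.

Lemma tnorm_eq_max (T : finType) (X : mat T T) U : unitary U ->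
  (forall M, numcontr M ->
    Normc.normc (trm (mulm M X)) <= Normc.normc (trm (mulm U X))) ->
  tnorm X = Normc.normc (trm (mulm U X)).
Proof.
move=> hU h; rewrite /tnorm; set S := (X in sup X).
have ub : ubound S (Normc.normc (trm (mulm U X))).
  by move=> _ [V hV <-]; apply/h/unitary_numcontr.
have inS : S (Normc.normc (trm (mulm U X))) by exists U.
apply/eqP; rewrite eq_le; apply/andP; split.
  by apply: ge_sup => //; exists (Normc.normc (trm (mulm U X))).
by apply: ub_le_sup => //; exists (Normc.normc (trm (mulm U X))).
Qed.

(** Together with [tnorm_le], this trades the supremum over unitaries for one over matrices of
    numerical radius at most one. Hermiticity of [X] is what reduces the pairing to values of
    quadratic forms. *)
Lemma le_tnorm (T : finType) (X M : mat T T) : herm X -> numcontr M ->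
  Normc.normc (trm (mulm M X)) <= tnorm X.
Proof.
by move=> /herm_trace_norm_attained[U hU h] hM; rewrite (tnorm_eq_max hU h) h.
Qed.

Lemma tnorm_le (T : finType) (X : mat T T) c : herm X ->
  (forall M, numcontr M -> Normc.normc (trm (mulm M X)) <= c) -> tnorm X <= c.
Proof.
move=> /herm_trace_norm_attained[U hU h] hc; rewrite (tnorm_eq_max hU h).
exact/hc/unitary_numcontr.
Qed.

Lemma tnorm_ge0 (T : finType) (X : mat T T) : herm X -> 0 <= tnorm X.
Proof.
move=> hX; apply: le_trans (le_tnorm hX (unitary_numcontr (unitary_idm T))).
exact: normc_ge0.
Qed.

Lemma tnorm_subm_triangle (T : finType) (X Y Z : mat T T) :
  herm X -> herm Y -> herm Z ->
  tnorm (subm X Z) <= tnorm (subm X Y) + tnorm (subm Y Z).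
Proof.
move=> hX hY hZ; apply: tnorm_le => [|M hM]; first exact: herm_subm.
have -> : trm (mulm M (subm X Z)) = trm (mulm M (subm X Y)) + trm (mulm M (subm Y Z)).
  rewrite !trm_mulm -big_split; apply: eq_bigr => i _; rewrite -big_split.
  by apply: eq_bigr => j _; rewrite /= /subm; ring.
rewrite (le_trans (normc_triangle _ _))// lerD// le_tnorm//; exact: herm_subm.
Qed.

Lemma tnorm_subm_refl (T : finType) (X : mat T T) : tnorm (subm X X) = 0.
Proof.
have e M : trm (mulm M (subm X X)) = 0.
  by rewrite trm_mulm !big1// => i _; rewrite big1// => j _; rewrite /subm subrr mulr0.
by rewrite (tnorm_eq_max (unitary_idm T)) => [|M _]; rewrite !e ?Normc.normc0.
Qed.

(** The components are the eigenvectors scaled by the square roots of their eigenvalues, each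
    eigenvalue being the value of the form on its eigenvector. *)
Lemma psd_rank1 (T : finType) (X : mat T T) : psd X ->
  exists phi : T -> T -> C, forall i j, X i j = \sum_k phi k i * conjc (phi k j).
Proof.
move=> pX; have /spectral_decomposition[W [d [WtW _ eX]]] := psd_herm pX.
have d0 k : 0 <= d k.
  have := pX (W ^~ k); rewrite -/(qf _ _) (_ : X = specmx W d); last first.
    by apply/funext => i; apply/funext => j; exact: eX.
  rewrite qf_specmx (bigD1 k) //= WtW eqxx sqn1 mulr1 big1 ?addr0 ?ler0c// => l.
  by rewrite WtW eq_sym => /negPf ->; rewrite sqn0 mulr0.
exists (fun k i => (Num.sqrt (d k))%:C * W i k) => i j; rewrite eX.
apply: eq_bigr => k _; rewrite -{1}(sqr_sqrtr (d0 k)) !rmorphM /= oppr0 !complexr0; ring.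
Qed.

End TraceNorm.

(** * LOCC channels *)

Section Kraus.
Variable R : realType.
Local Notation C := R[i].
Local Notation mat := (mat R).

Lemma sum_pair (V : nmodType) (T U : finType) (F : T * U -> V) :
  \sum_p F p = \sum_i \sum_j F (i, j).
Proof. by rewrite pair_bigA; apply: eq_bigr => -[]. Qed.

Lemma app_mulm (T U V : finType) (K : mat T U) (L : mat U V) w :
  app (mulm K L) w = app K (app L w).
Proof.
apply/funext => x; rewrite /app /mulm; under eq_bigr do rewrite mulr_suml.
rewrite exchange_big; apply: eq_bigr => j _; rewrite mulr_sumr.
by apply: eq_bigr => i _; rewrite mulrA.
Qed.

Lemma mulmA (T U V Z : finType) (X : mat T U) (Y : mat U V) (W : mat V Z) :
  mulm X (mulm Y W) = mulm (mulm X Y) W.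
Proof.
apply/funext => x; apply/funext => y; rewrite /mulm.
under eq_bigr do rewrite mulr_sumr.
rewrite exchange_big; apply: eq_bigr => j _; rewrite mulr_suml.
by apply: eq_bigr => i _; rewrite mulrA.
Qed.

Lemma adjm_mulm (T U V : finType) (K : mat T U) (L : mat U V) :
  adjm (mulm K L) = mulm (adjm L) (adjm K).
Proof.
apply/funext => x; apply/funext => y; rewrite /mulm /adjm rmorph_sum.
by apply: eq_bigr => i _; rewrite rmorphM mulrC.
Qed.

Lemma sandw_mulm (T U V : finType) (K : mat T U) (L : mat U V) X :
  sandw (mulm K L) X = sandw K (sandw L X).
Proof. by rewrite /sandw adjm_mulm !mulmA. Qed.

Lemma mulm1 (T U : finType) (K : mat T U) : mulm K (idm U) = K.
Proof.
apply/funext => x; apply/funext => y; rewrite /mulm /idm (bigD1 y) //= eqxx mulr1.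
by rewrite big1 ?addr0// => i /negPf ->; rewrite mulr0.
Qed.

Lemma mul1m (T U : finType) (K : mat T U) : mulm (idm T) K = K.
Proof.
apply/funext => x; apply/funext => y; rewrite /mulm /idm (bigD1 x) //= eqxx mul1r.
by rewrite big1 ?addr0// => i; rewrite eq_sym => /negPf ->; rewrite mul0r.
Qed.

Lemma mulm_kron (T U V T' U' V' : finType) (K : mat T U) (L : mat U V)
    (K' : mat T' U') (L' : mat U' V') :
  mulm (kron K K') (kron L L') = kron (mulm K L) (mulm K' L').
Proof.
apply/funext => x; apply/funext => y; rewrite /mulm /kron.
rewrite sum_pair /=.
rewrite mulr_suml; apply: eq_bigr => i _; rewrite mulr_sumr.
by apply: eq_bigr => j _; ring.
Qed.

Lemma sandw_sum (T U : finType) (K : mat T U) (I : Type) (s : seq I) (X : I -> mat U U) x y :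
  sandw K (fun i j => \sum_(k <- s) X k i j) x y = \sum_(k <- s) sandw K (X k) x y.
Proof.
under [RHS]eq_bigr do rewrite sandwE; rewrite sandwE [RHS]exchange_big.
apply: eq_bigr => i _; rewrite [RHS]exchange_big; apply: eq_bigr => j _ /=.
by rewrite mulr_sumr mulr_suml.
Qed.

(** Trace preservation tested on vectors: in this form the successive rounds of a protocol chain by
    plain substitution. *)
Definition isometric (T U I : finType) (K : I -> mat T U) :=
  forall w, \sum_k nrm (app (K k) w) = nrm w.

Lemma tp_isometric (T U I : finType) (K : I -> mat T U) : tp_kraus K -> isometric K.
Proof.
move=> h w; apply: complexI; rewrite -qf_idm rmorph_sum /=.
under eq_bigr do rewrite nrm_app.
by rewrite -qf_sum; apply: eq_qf => i j; rewrite -h.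
Qed.

Lemma nrm_kronl (T U B : finType) (K : mat T U) w :
  nrm (app (kron K (idm B)) w) = \sum_b nrm (app K (fun a => w (a, b))).
Proof.
rewrite /nrm exchange_big /= pair_bigA; apply: eq_bigr => -[a b] _ /=.
congr sqn; rewrite /app /kron /idm /=.
rewrite sum_pair /=.
apply: eq_bigr => i _; rewrite (bigD1 b) //= eqxx mulr1 big1 ?addr0// => j.
by rewrite eq_sym => /negPf ->; rewrite mulr0 mul0r.
Qed.

Lemma nrm_kronr (T U A : finType) (K : mat T U) w :
  nrm (app (kron (idm A) K) w) = \sum_a nrm (app K (fun b => w (a, b))).
Proof.
rewrite /nrm pair_bigA; apply: eq_bigr => -[a b] _ /=.
congr sqn; rewrite /app /kron /idm /=.
rewrite sum_pair /=.
rewrite exchange_big; apply: eq_bigr => j _ /=.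
rewrite (bigD1 a) //= eqxx mul1r big1 ?addr0// => i.
by rewrite eq_sym => /negPf ->; rewrite !mul0r.
Qed.

Lemma isometric_kronl (T U B I : finType) (K : I -> mat T U) :
  isometric K -> isometric (fun k => kron (K k) (idm B)).
Proof.
move=> h w; under eq_bigr do rewrite nrm_kronl.
rewrite exchange_big /nrm sum_pair /=.
by rewrite [RHS]exchange_big; apply: eq_bigr => b _; rewrite h.
Qed.

Lemma isometric_kronr (T U A I : finType) (K : I -> mat T U) :
  isometric K -> isometric (fun k => kron (idm A) (K k)).
Proof.
move=> h w; under eq_bigr do rewrite nrm_kronr.
rewrite exchange_big /nrm sum_pair /=.
by apply: eq_bigr => a _; rewrite h.
Qed.

Lemma kron_split (T U T' U' : finType) (K : mat T U) (L : mat T' U') :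
  kron K L = mulm (kron K (idm T')) (kron (idm U) L).
Proof. by rewrite mulm_kron mulm1 mul1m. Qed.

(** A separable channel given by explicit product Kraus operators. It is a list rather than an
    indexed family because the branches of a protocol may use different numbers of operators. *)
Definition sepkraus (A B A' B' : finType) (s : seq (mat A' A * mat B' B))
    (Lam : bop R A B -> bop R A' B') :=
  (forall X x y, Lam X x y = \sum_(p <- s) sandw (kron p.1 p.2) X x y) /\
  (forall w, \sum_(p <- s) nrm (app (kron p.1 p.2) w) = nrm w).

(** A local operation composed with a product operator is again a product operator, and branching on
    an outcome concatenates the lists of the branches. *)
Lemma LOCC_sepkraus (A B A' B' : finType) (Lam : bop R A B -> bop R A' B') :
  LOCC Lam -> exists s, sepkraus s Lam.
Proof.
elim=> {A B A' B' Lam}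
  [A B A' B' I J K L /tp_isometric hK /tp_isometric hL
  |A B A'' A' B' I J K Psi /tp_isometric hK _ IH
  |A B B'' A' B' I J L Psi /tp_isometric hL _ IH].
- exists (flatten [seq [seq (K i, L j) | j <- index_enum J] | i <- index_enum I]).
  split=> [X x y|w]; rewrite big_flatten big_map.
    by apply: eq_bigr => i _; rewrite big_map.
  under eq_bigr do rewrite big_map; rewrite /= exchange_big /= -[RHS](isometric_kronr hL).
  apply: eq_bigr => j _; rewrite -[RHS](isometric_kronl hK).
  by apply: eq_bigr => i _; rewrite -app_mulm -kron_split.
- have /choice[s hs] := IH.
  exists (flatten [seq flatten [seq [seq (mulm p.1 (K i j), p.2) | j <- index_enum J]
    | p <- s i] | i <- index_enum I]); split=> [X x y|w].
    rewrite big_flatten big_map; apply: eq_bigr => i _ /=.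
    rewrite big_flatten big_map (hs i).1; apply: eq_bigr => p _ /=.
    rewrite big_map sandw_sum; apply: eq_bigr => j _ /=.
    by rewrite -sandw_mulm mulm_kron mulm1.
  rewrite big_flatten big_map -[RHS](isometric_kronl hK) sum_pair.
  apply: eq_bigr => i _; rewrite big_flatten big_map.
  under eq_bigr do rewrite big_map; rewrite exchange_big; apply: eq_bigr => j _ /=.
  by rewrite -(hs i).2; apply: eq_bigr => p _; rewrite -app_mulm mulm_kron mulm1.
- have /choice[s hs] := IH.
  exists (flatten [seq flatten [seq [seq (p.1, mulm p.2 (L i j)) | j <- index_enum J]
    | p <- s i] | i <- index_enum I]); split=> [X x y|w].
    rewrite big_flatten big_map; apply: eq_bigr => i _ /=.
    rewrite big_flatten big_map (hs i).1; apply: eq_bigr => p _ /=.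
    rewrite big_map sandw_sum; apply: eq_bigr => j _ /=.
    by rewrite -sandw_mulm mulm_kron mulm1.
  rewrite big_flatten big_map -[RHS](isometric_kronr hL) sum_pair.
  apply: eq_bigr => i _; rewrite big_flatten big_map.
  under eq_bigr do rewrite big_map; rewrite exchange_big; apply: eq_bigr => j _ /=.
  by rewrite -(hs i).2; apply: eq_bigr => p _; rewrite -app_mulm mulm_kron mulm1.
Qed.

Lemma LOCC_sum (A B A' B' : finType) (Lam : bop R A B -> bop R A' B')
    (I : Type) (s : seq I) (X : I -> bop R A B) x y : LOCC Lam ->
  Lam (fun i j => \sum_(k <- s) X k i j) x y = \sum_(k <- s) Lam (X k) x y.
Proof.
move=> /LOCC_sepkraus[t [ht _]]; rewrite ht.
under eq_bigr do rewrite sandw_sum.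
by rewrite exchange_big; apply: eq_bigr => k _; rewrite ht.
Qed.

Lemma LOCC_subm (A B A' B' : finType) (Lam : bop R A B -> bop R A' B') X Y :
  LOCC Lam -> Lam (subm X Y) = subm (Lam X) (Lam Y).
Proof.
move=> /LOCC_sepkraus[t [ht _]]; apply/funext => x; apply/funext => y.
rewrite /subm !ht -sumrB; apply: eq_bigr => p _; rewrite !sandwE -sumrB.
by apply: eq_bigr => i _; rewrite -sumrB; apply: eq_bigr => j _; ring.
Qed.

Lemma LOCC_herm (A B A' B' : finType) (Lam : bop R A B -> bop R A' B') X :
  LOCC Lam -> herm X -> herm (Lam X).
Proof.
move=> /LOCC_sepkraus[t [ht _]] hX x y; rewrite !ht.
exact: (@herm_sum R _ _ t (fun p => sandw (kron p.1 p.2) X)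
  (fun p => herm_sandw _ hX) x y).
Qed.

(** The dual channel preserves numerical radius at most one: |<w, N w>| is at most the sum of |<K w,
    M K w>| over the Kraus operators K, hence at most the sum of |K w|^2, which is |w|^2. *)
Lemma LOCC_tnorm (A B A' B' : finType) (Lam : bop R A B -> bop R A' B') X :
  LOCC Lam -> herm X -> tnorm (Lam X) <= tnorm X.
Proof.
move=> hL hX; apply: tnorm_le => [|M hM]; first exact: LOCC_herm.
have [t [ht hn]] := LOCC_sepkraus hL.
pose N : bop R A B := fun i j => \sum_(p <- t) sandw (adjm (kron p.1 p.2)) M i j.
have -> : trm (mulm M (Lam X)) = trm (mulm N X).
  have -> : Lam X = fun x y => \sum_(p <- t) sandw (kron p.1 p.2) X x y.
    by apply/funext => x; apply/funext => y; exact: ht.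
  rewrite trm_mulm_sum trm_mulmC trm_mulm_sum; apply: eq_bigr => p _.
  by rewrite trm_sandw trm_mulmC.
apply: le_tnorm => // w; rewrite qf_sum (le_trans (normc_sum _ _ _))// -hn.
apply: ler_sum => p _; rewrite qf_sandw.
have -> : adjm (adjm (kron p.1 p.2)) = kron p.1 p.2; last exact: hM.
by apply/funext => x; apply/funext => y; rewrite /adjm conjcK.
Qed.

Lemma sum_unit (V : nmodType) (F : unit -> V) : \sum_i F i = F tt.
Proof. by rewrite (big_pred1 tt) //; case. Qed.

(** An instrument with a single outcome: the index type [unit] makes the broadcast empty. *)
Lemma LOCC_Alice_channel (A B A'' A' B' J : finType) (K : J -> mat A'' A)
    (Psi : bop R A'' B -> bop R A' B') :
  tp_kraus K -> LOCC Psi ->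
  LOCC (fun X => Psi (fun u v => \sum_j sandw (kron (K j) (idm B)) X u v)).
Proof.
move=> hK hP; pose K' (_ : unit) := K.
rewrite (_ : (fun X => _) = (fun X => fun x y => \sum_(i : unit) Psi (fun u v =>
  \sum_j sandw (kron (K' i j) (idm B)) X u v) x y)); last first.
  by apply/funext => X; apply/funext => x; apply/funext => y; rewrite sum_unit.
apply: (@LOCC_Alice R A B A'' A' B' unit J K' (fun=> Psi)) => // x y.
by rewrite sum_pair sum_unit -hK.
Qed.

Lemma LOCC_Bob_channel (A B B'' A' B' J : finType) (L : J -> mat B'' B)
    (Psi : bop R A B'' -> bop R A' B') :
  tp_kraus L -> LOCC Psi ->
  LOCC (fun X => Psi (fun u v => \sum_j sandw (kron (idm A) (L j)) X u v)).
Proof.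
move=> hL hP; pose L' (_ : unit) := L.
rewrite (_ : (fun X => _) = (fun X => fun x y => \sum_(i : unit) Psi (fun u v =>
  \sum_j sandw (kron (idm A) (L' i j)) X u v) x y)); last first.
  by apply/funext => X; apply/funext => x; apply/funext => y; rewrite sum_unit.
apply: (@LOCC_Bob R A B B'' A' B' unit J L' (fun=> Psi)) => // x y.
by rewrite sum_pair sum_unit -hL.
Qed.

(** Induction on the protocol that runs first, pushing the second one into its branches by
    additivity. In the base case a local channel splits into a channel of Alice followed by a
    channel of Bob, each prefixed to the second protocol. *)
Lemma LOCC_comp (A B A' B' : finType) (Lam : bop R A B -> bop R A' B') :
  LOCC Lam -> forall (A2 B2 : finType) (Lam' : bop R A' B' -> bop R A2 B2),
  LOCC Lam' -> LOCC (Lam' \o Lam).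
Proof.
elim=> {A B A' B' Lam}
  [A B A' B' I J K L hK hL
  |A B A'' A' B' I J K Psi hK hP IH
  |A B B'' A' B' I J L Psi hL hP IH] A2 B2 Lam' hLam'.
- rewrite (_ : _ \o _ = fun X => Lam' (fun u v => \sum_j sandw (kron (idm A') (L j))
    (fun u v => \sum_i sandw (kron (K i) (idm B)) X u v) u v)).
    exact: (LOCC_Alice_channel hK (LOCC_Bob_channel hL hLam')).
  apply/funext => X /=; congr Lam'; apply/funext => x; apply/funext => y.
  rewrite exchange_big; apply: eq_bigr => j _; rewrite sandw_sum.
  by apply: eq_bigr => i _; rewrite -sandw_mulm mulm_kron mulm1 mul1m.
- rewrite (_ : _ \o _ = fun X => fun x y => \sum_i (Lam' \o Psi i) (fun u v =>
    \sum_j sandw (kron (K i j) (idm B)) X u v) x y).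
    apply: (@LOCC_Alice R A B A'' A2 B2 I J K (fun i => Lam' \o Psi i)) => // i.
    exact: IH.
  by apply/funext => X; apply/funext => x; apply/funext => y; rewrite /= LOCC_sum.
- rewrite (_ : _ \o _ = fun X => fun x y => \sum_i (Lam' \o Psi i) (fun u v =>
    \sum_j sandw (kron (idm A) (L i j)) X u v) x y).
    apply: (@LOCC_Bob R A B B'' A2 B2 I J L (fun i => Lam' \o Psi i)) => // i.
    exact: IH.
  by apply/funext => X; apply/funext => x; apply/funext => y; rewrite /= LOCC_sum.
Qed.

Lemma sum_swap (V : nmodType) (T U : finType) (F : T * U -> V) :
  \sum_p F p = \sum_(q : U * T) F (q.2, q.1).
Proof. by rewrite !sum_pair exchange_big. Qed.

Lemma swapop_sandw (A B A' B' : finType) (K : mat A' A) (L : mat B' B) X :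
  swapop (sandw (kron K L) X) = sandw (kron L K) (swapop X).
Proof.
apply/funext => x; apply/funext => y; rewrite /swapop !sandwE sum_swap.
apply: eq_bigr => i _; rewrite sum_swap; apply: eq_bigr => j _ /=.
by rewrite /kron /= [K x.2 _ * _]mulrC [K y.2 _ * _]mulrC.
Qed.

Lemma swapopK (A B : finType) (X : bop R A B) : swapop (swapop X) = X.
Proof. by apply/funext => -[a b]; apply/funext => -[c d]. Qed.

Lemma LOCC_swap (A B A' B' : finType) (Lam : bop R A B -> bop R A' B') :
  LOCC Lam -> LOCC (fun X => swapop (Lam (swapop X))).
Proof.
elim=> {A B A' B' Lam}
  [A B A' B' I J K L hK hL
  |A B A'' A' B' I J K Psi hK hP IH
  |A B B'' A' B' I J L Psi hL hP IH].
- rewrite (_ : (fun X => _) = fun X => fun x y =>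
    \sum_j \sum_i sandw (kron (L j) (K i)) X x y); first exact: LOCC_local.
  apply/funext => X; apply/funext => x; apply/funext => y; rewrite exchange_big.
  rewrite /swapop; apply: eq_bigr => i _; apply: eq_bigr => j _.
  by rewrite -[X in RHS]swapopK -swapop_sandw.
- rewrite (_ : (fun X => _) = fun X => fun x y => \sum_i swapop (Psi i (swapop (fun u v =>
    \sum_j sandw (kron (idm B) (K i j)) X u v))) x y); first
    exact: (@LOCC_Bob R B A A'' B' A' I J K (fun i Y => swapop (Psi i (swapop Y)))).
  apply/funext => X; apply/funext => x; apply/funext => y.
  rewrite /swapop; apply: eq_bigr => i _.
  congr (Psi i _ _ _); apply/funext => u; apply/funext => v; apply: eq_bigr => j _.
  by rewrite -[X in RHS]swapopK -swapop_sandw.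
- rewrite (_ : (fun X => _) = fun X => fun x y => \sum_i swapop (Psi i (swapop (fun u v =>
    \sum_j sandw (kron (L i j) (idm A)) X u v))) x y); first
    exact: (@LOCC_Alice R B A B'' B' A' I J L (fun i Y => swapop (Psi i (swapop Y)))).
  apply/funext => X; apply/funext => x; apply/funext => y.
  rewrite /swapop; apply: eq_bigr => i _.
  congr (Psi i _ _ _); apply/funext => u; apply/funext => v; apply: eq_bigr => j _.
  by rewrite -[X in RHS]swapopK -swapop_sandw.
Qed.

Lemma herm_swapop (A B : finType) (X : bop R A B) : herm X -> herm (swapop X).
Proof. by move=> hX x y; rewrite /swapop hX. Qed.

Lemma tnorm_swapop (A B : finType) (X : bop R A B) : herm X ->
  tnorm (swapop X) <= tnorm X.
Proof.
move=> hX; apply: tnorm_le => [|M hM]; first exact: herm_swapop.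
have -> : trm (mulm M (swapop X)) = trm (mulm (swapop M) X).
  rewrite !trm_mulm sum_swap; apply: eq_bigr => i _; rewrite sum_swap.
  by apply: eq_bigr => -[j1 j2] _; case: i.
apply: le_tnorm => // w; have := hM (fun i => w (i.2, i.1)).
rewrite /nrm [X in _ <= X -> _]sum_swap.
have -> : qf M (fun i => w (i.2, i.1)) = qf (swapop M) w.
  rewrite /qf sum_swap; apply: eq_bigr => -[i1 i2] _; rewrite sum_swap.
  by apply: eq_bigr => -[j1 j2] _.
move/le_trans; apply; rewrite le_eqVlt; apply/orP; left; apply/eqP.
by apply: eq_bigr => -[].
Qed.

End Kraus.

(** * Transition rates *)

Section Rates.
Variable R : realType.
Local Notation C := R[i].
Local Notation mat := (mat R).

Lemma prod_sum_pair (V : comPzSemiRingType) (n : nat) (A B : finType)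
    (F : 'I_n -> A * B -> V) :
  \prod_(k < n) \sum_p F k p
  = \sum_(x : {ffun 'I_n -> A} * {ffun 'I_n -> B}) \prod_(k < n) F k (x.1 k, x.2 k).
Proof.
under eq_bigr do rewrite sum_pair.
rewrite bigA_distr_bigA sum_pair /=; apply: eq_bigr => f _.
by rewrite bigA_distr_bigA.
Qed.

Lemma herm_tpow (A B : finType) (rho : bop R A B) n : herm rho -> herm (tpow rho n).
Proof.
by move=> h x y; rewrite rmorph_prod; apply: eq_bigr => k _; rewrite /= h.
Qed.

Lemma trm_tpow (A B : finType) (rho : bop R A B) n : trm (tpow rho n) = trm rho ^+ n.
Proof.
rewrite /trm /tpow -(prod_sum_pair (fun (k : 'I_n) p => rho p p)).
by rewrite prodr_const card_ord.
Qed.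

Lemma card_ffun0 (T : finType) : #|{ffun 'I_0 -> T}| = 1%N.
Proof. by rewrite card_ffun card_ord. Qed.

Lemma sum_ffun0 (V : nmodType) (T : finType) (c : V) :
  \sum_(x : {ffun 'I_0 -> T}) c = c.
Proof. by rewrite sumr_const card_ffun0. Qed.

Lemma tp_discard (T U : finType) :
  tp_kraus (fun (a : T) (_ : {ffun 'I_0 -> U}) a' => (a' == a)%:R : C).
Proof.
move=> x y; rewrite /mulm /adjm; under eq_bigr do rewrite sum_ffun0.
rewrite (bigD1 x) //= eqxx rmorph1 mul1r big1 => [|i].
  by rewrite addr0 /idm eq_sym.
by rewrite eq_sym => /negPf ->; rewrite rmorph0 mul0r.
Qed.

(** Both parties discard everything into the one-point space that indexes zero copies; the output is
    the trace of the input, which is 1. This makes every set of achievable rates nonempty. *)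
Lemma achievable0 (A B A' B' : finType) (rho : bop R A B) (sigma : bop R A' B') :
  trm rho = 1 -> achievable rho sigma 0.
Proof.
move=> rho1; split => //; exists (fun=> 0%N).
pose Ka (T U : finType) (a : T) (_ : {ffun 'I_0 -> U}) a' : C := (a' == a)%:R.
exists (fun n X x y => \sum_a \sum_b
  sandw (kron (@Ka {ffun 'I_n -> A} A' a) (@Ka {ffun 'I_n -> B} B' b)) X x y).
split => [n|]; first by apply: LOCC_local; exact: tp_discard.
split; first by under eq_fun do rewrite mul0r; exact: cvg_cst.
suff e n : (fun x y => \sum_a \sum_b sandw (kron (@Ka {ffun 'I_n -> A} A' a)
    (@Ka {ffun 'I_n -> B} B' b)) (tpow rho n) x y) = tpow sigma 0.
  by under eq_fun do rewrite e tnorm_subm_refl; exact: cvg_cst.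
apply/funext => x; apply/funext => y.
transitivity (trm (tpow rho n)); last by rewrite trm_tpow rho1 expr1n /tpow big_ord0.
rewrite /trm sum_pair; apply: eq_bigr => a _; apply: eq_bigr => b _.
rewrite sandwE (bigD1 (a, b)) //= (bigD1 (a, b)) //=.
rewrite /kron /Ka /= !eqxx !mulr1n !mulr1 conjc1 mul1r mulr1 !big1 ?addr0//.
  move=> [a1 b1] /negPf; rewrite xpair_eqE => h; rewrite big1// => j _.
  by rewrite -natrM mulnb h !mul0r.
move=> [a1 b1] /negPf; rewrite xpair_eqE => h.
by rewrite -natrM mulnb h rmorph0 mulr0.
Qed.

Lemma natseq_cvg_oo (m : nat -> nat) (r : R) : 0 < r ->
  (fun n => (m n)%:R / n%:R : R) @ \oo --> r -> m @ \oo --> \oo.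
Proof.
move=> r0 hm; apply/cvgnyPge => N.
have h1 : \forall n \near \oo, r / 2 < (m n)%:R / n%:R :> R.
  by apply: (cvgr_gt _ hm); lra.
have h2 : \forall n \near \oo, N%:R / (r / 2) <= n%:R :> R.
  by exact: nbhs_infty_ger.
near=> n; rewrite -(ler_nat R).
have n0 : (0 : R) < n%:R by rewrite ltr0n; near: n; exact: nbhs_infty_gt.
have a : r / 2 < (m n)%:R / n%:R by near: n.
have b : N%:R / (r / 2) <= n%:R by near: n.
rewrite ltr_pdivlMr// in a; rewrite ler_pdivrMr ?divr_gt0// in b.
by rewrite (le_trans b)// mulrC ltW.
Unshelve. all: by end_near. Qed.

(** The second protocol runs on the [m1 n] copies produced by the first. Contractivity keeps the
    first error from growing, and the triangle inequality adds the second. *)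
Lemma achievable_trans (A B A' B' A2 B2 : finType) (rho : bop R A B)
    (sigma : bop R A' B') (tau : bop R A2 B2) r1 r2 :
  trm rho = 1 -> herm rho -> herm sigma -> herm tau ->
  achievable rho sigma r1 -> achievable sigma tau r2 ->
  achievable rho tau (r1 * r2).
Proof.
move=> rho1 hrho hsigma htau [r1_ge0 [m1 [L1 [locc1 [m1r t1]]]]].
move=> [r2_ge0 [m2 [L2 [locc2 [m2r t2]]]]].
(* At rate 0 the sequence [m1] may stay bounded, and then the error of the second protocol along
   [m1] has no reason to vanish. *)
have [->|r1_neq0] := eqVneq r1 0; first by rewrite mul0r; exact: achievable0.
have r1_gt0 : 0 < r1 by rewrite lt_neqAle eq_sym r1_neq0.
have m1oo := natseq_cvg_oo r1_gt0 m1r.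
split; first exact: mulr_ge0.
exists (m2 \o m1), (fun n => L2 (m1 n) \o L1 n); split => [n|].
  exact: LOCC_comp.
split.
  have h : (fun n => (m1 n)%:R / n%:R * ((m2 (m1 n))%:R / (m1 n)%:R) : R) @ \oo
      --> r1 * r2 by apply: cvgM => //; exact: (cvg_comp _ _ m1oo m2r).
  apply: cvg_trans h; apply: near_eq_cvg.
  have /cvgnyPge/(_ 1%N) := m1oo.
  apply: filterS => n m1_gt0 /=.
  by rewrite mulrC mulrA divfK// pnatr_eq0 -lt0n.
have h : (fun n => tnorm (subm (L1 n (tpow rho n)) (tpow sigma (m1 n))) +
   tnorm (subm (L2 (m1 n) (tpow sigma (m1 n))) (tpow tau (m2 (m1 n))))) @ \oo --> (0 : R).
  by rewrite -[0](addr0 0); apply: cvgD => //; exact: (cvg_comp _ _ m1oo t2).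
apply: (squeeze_cvgr _ (cvg_cst 0) h); apply: nearW => n /=.
have hL1 : herm (L1 n (tpow rho n)) by apply: LOCC_herm => //; exact: herm_tpow.
have hL2 X : herm X -> herm (L2 (m1 n) X) by exact: LOCC_herm.
have hs : herm (tpow sigma (m1 n)) by exact: herm_tpow.
have ht : herm (tpow tau (m2 (m1 n))) by exact: herm_tpow.
apply/andP; split.
  by apply: tnorm_ge0; apply: herm_subm => //; exact: hL2.
apply: le_trans (tnorm_subm_triangle (hL2 _ hL1) (hL2 _ hs) ht) _.
by rewrite lerD2r -LOCC_subm// LOCC_tnorm//; exact: herm_subm.
Qed.

Lemma achievable_swap (A B A' B' : finType) (rho : bop R A B) (sigma : bop R A' B') r :
  herm rho -> herm sigma ->
  achievable rho sigma r -> achievable (swapop rho) (swapop sigma) r.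
Proof.
move=> hrho hsigma [r0 [m [L [hL [mr t]]]]]; split => //.
exists m, (fun n X => swapop (L n (swapop X))); split => [n|]; first exact: LOCC_swap.
split => //; apply: (squeeze_cvgr _ (cvg_cst 0) t); apply: nearW => n /=.
have h : herm (subm (L n (tpow rho n)) (tpow sigma (m n))).
  by apply: herm_subm; [apply: LOCC_herm => //; exact: herm_tpow|exact: herm_tpow].
apply/andP; split; last exact: (tnorm_swapop h).
exact: (tnorm_ge0 (herm_swapop h)).
Qed.

Lemma herm_psi_plus : herm (@psi_plus R).
Proof.
move=> x y; rewrite /psi_plus andbC; case: ifP => _; last by rewrite rmorph0.
by rewrite fmorphV rmorph_nat.
Qed.

Lemma swapop_psi_plus : swapop (@psi_plus R) = psi_plus.
Proof.
apply/funext => x; apply/funext => y; rewrite /swapop /psi_plus /=.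
by rewrite [x.2 == _]eq_sym [y.2 == _]eq_sym.
Qed.

Lemma trm_psi_plus : trm (@psi_plus R) = 1.
Proof.
by rewrite /trm sum_pair !big_ord_recl !big_ord0 /psi_plus /=; field.
Qed.

End Rates.

(** * Rates as extended real suprema *)

Section ExtendedRates.
Local Open Scope ereal_scope.
Variable R : realType.

Lemma rate_ge0 (A B A' B' : finType) (rho : bop R A B) (sigma : bop R A' B') :
  trm rho = 1%R -> 0 <= rate rho sigma.
Proof.
by move=> h; apply: ereal_sup_ubound; exists 0%R => //; exact: achievable0.
Qed.

(** If the second supremum is infinite, any positive element of [S1] already forces [c] to be +oo;
    if no such element exists the first supremum is 0 and the product is 0 by convention. *)
Lemma mule_ereal_sup_le (S1 S2 : set R) (c : \bar R) :
  S1 0%R -> S2 0%R ->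
  (forall a, S1 a -> (0 <= a)%R) ->
  (forall a b, S1 a -> S2 b -> (a * b)%:E <= c) ->
  ereal_sup [set r%:E | r in S1] * ereal_sup [set r%:E | r in S2] <= c.
Proof.
move=> S10 S20 S1_ge0 h.
have c0 : 0 <= c by have := h _ _ S10 S20; rewrite mulr0.
set x := ereal_sup _; set y := ereal_sup _.
have x0 : 0 <= x by apply: ereal_sup_ubound; exists 0%R.
have y0 : 0 <= y by apply: ereal_sup_ubound; exists 0%R.
have ay a : S1 a -> a%:E * y <= c.
  move=> Sa; have [->|a0] := eqVneq a 0%R; first by rewrite mul0e.
  have a_gt0 : (0 < a)%R by rewrite lt_neqAle eq_sym a0 S1_ge0.
  rewrite -lee_pdivlMl//; apply: ge_ereal_sup => _ [b Sb <-].
  by rewrite lee_pdivlMl// -EFinM h.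
case: (ltgtP y 0) => [|y_gt0|->]; [by rewrite ltNge y0| |by rewrite mule0].
case ey : y y0 y_gt0 ay => [s| |] // y0 y_gt0 ay.
  rewrite lte_fin in y_gt0.
  rewrite -lee_pdivlMr//; apply: ge_ereal_sup => _ [a Sa <-].
  by rewrite lee_pdivlMr// ay.
have [x_gt0|] := ltP 0 x; last first.
  by move=> x_le0; have -> : x = 0 by [apply/eqP; rewrite eq_le x_le0]; rewrite mul0e.
have [_ [a Sa <-] a_gt0] := ereal_sup_gt x_gt0.
by have := ay _ Sa; rewrite gt0_muley// leye_eq => /eqP ->; rewrite leey.
Qed.

Lemma rate_trans (A B A' B' A2 B2 : finType) (rho : bop R A B)
    (sigma : bop R A' B') (tau : bop R A2 B2) :
  trm rho = 1%R -> trm sigma = 1%R -> herm rho -> herm sigma -> herm tau ->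
  rate rho sigma * rate sigma tau <= rate rho tau.
Proof.
move=> rho1 sigma1 hrho hsigma htau; apply: mule_ereal_sup_le.
- exact: achievable0.
- exact: achievable0.
- by move=> a [].
- move=> a b ha hb; apply: ereal_sup_ubound; exists (a * b)%R => //.
  exact: achievable_trans ha hb.
Qed.

Lemma rate_psi_plus_swap (A B : finType) (rho : bop R A B) : herm rho ->
  rate psi_plus (swapop rho) = rate psi_plus rho.
Proof.
move=> hrho; congr ereal_sup; apply/seteqP; split=> _ [r hr <-]; exists r => //.
  rewrite -[rho]swapopK -swapop_psi_plus.
  by apply: achievable_swap; [exact: herm_psi_plus|exact: herm_swapop|].
rewrite -swapop_psi_plus; apply: achievable_swap => //; exact: herm_psi_plus.
Qed.

End ExtendedRates.

(** * Teleportation *)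

Section Teleportation.
Variable R : realType.
Local Notation C := R[i].
Local Notation mat := (mat R).

Local Notation qubits n := {ffun 'I_n -> 'I_2}.

Lemma sum_delta (V : pzSemiRingType) (T : finType) (x : T) (F : T -> V) :
  \sum_y (x == y)%:R * F y = F x.
Proof.
rewrite (bigD1 x) //= eqxx mul1r big1 ?addr0// => y.
by rewrite eq_sym => /negPf ->; rewrite mul0r.
Qed.

(** The character (-1)^(t.z) of the group of bit strings. *)
Definition psign (n : nat) (t z : qubits n) : R :=
  \prod_(k < n) (if (t k != 0) && (z k != 0) then -1 else 1).

Lemma psign_sqr n (t z : qubits n) : psign t z * psign t z = 1.
Proof.
rewrite -big_split big1// => k _ /=; case: ifP => _; first by rewrite mulrNN mulr1.
by rewrite mulr1.
Qed.

Lemma psign_sum n (z z' : qubits n) :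
  \sum_t psign t z * psign t z' = 2 ^+ n * (z == z')%:R.
Proof.
under eq_bigr do rewrite -big_split /=.
rewrite -(bigA_distr_bigA (fun k (t : 'I_2) => (if (t != 0) && (z k != 0) then -1 else 1) *
  (if (t != 0) && (z' k != 0) then -1 else 1))) /=.
have e k : \sum_(t : 'I_2) ((if (t != 0) && (z k != 0) then -1 else 1) *
  (if (t != 0) && (z' k != 0) then -1 else 1)) = 2 * (z k == z' k)%:R :> R.
  by case: (z k) => [[|[]]] // ?; case: (z' k) => [[|[]]] // ?;
    rewrite !big_ord_recl big_ord0 /=; ring.
under eq_bigr do rewrite e.
rewrite big_split /= prodr_const card_ord; congr (_ * _).
have [->|nz] := eqVneq z z'; first by rewrite big1// => k _; rewrite eqxx.
have [k nk] : exists k, z k != z' k.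
  by apply/existsP; rewrite -negb_forall; apply: contra nz => /forallP h;
    apply/eqP/ffunP => k; apply/eqP.
by rewrite (bigD1 k) //= (negPf nk) mul0r.
Qed.

(** The Pauli operator X^q.1 Z^q.2 on [n] qubits. Its entries are real, so transposition serves as
    adjoint. *)
Definition pauli n (q : qubits n * qubits n)
  (y z : qubits n) : R := (y == z + q.1)%:R * psign q.2 z.

Lemma pauli_col n (q : qubits n * qubits n) z z' :
  \sum_y pauli q y z * pauli q y z' = (z == z')%:R.
Proof.
transitivity (\sum_y (z + q.1 == y)%:R * ((y == z' + q.1)%:R * (psign q.2 z * psign q.2 z'))).
  by apply: eq_bigr => y _; rewrite /pauli [z + _ == _]eq_sym; ring.
rewrite sum_delta (inj_eq (addIr _)); case: eqP => [->|_]; last by rewrite mul0r.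
by rewrite psign_sqr mulr1.
Qed.

Lemma pauli_row n (q : qubits n * qubits n) y y' :
  \sum_z pauli q y z * pauli q y' z = (y == y')%:R.
Proof.
transitivity (\sum_z (y - q.1 == z)%:R * ((y' - q.1 == z)%:R * (psign q.2 z * psign q.2 z))).
  by apply: eq_bigr => z _; rewrite /pauli !subr_eq; ring.
by rewrite sum_delta (inj_eq (addIr _)) psign_sqr mulr1 eq_sym.
Qed.

(** The shift imposes y - z = y' - z', and orthogonality of the characters imposes z = z'. This is
    the completeness relation behind the Bell measurement. *)
Lemma pauli_twirl n y y' z z' :
  \sum_q @pauli n q y z * pauli q y' z' = 2 ^+ n * (y == y')%:R * (z == z')%:R.
Proof.
rewrite sum_pair /=.
transitivity (\sum_u (y - z == u)%:R * (y' - z' == u)%:R * \sum_t psign t z * psign t z').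
  apply: eq_bigr => u _; rewrite mulr_sumr; apply: eq_bigr => t _.
  by rewrite /pauli /= !subr_eq ![u + _]addrC; ring.
under eq_bigr do rewrite -mulrA; rewrite sum_delta psign_sum.
case: (eqVneq z z') => [->|_]; last by rewrite !mulr0.
by rewrite (inj_eq (addIr _)) eq_sym; ring.
Qed.

Lemma prod_delta n (T : finType) (f g : {ffun 'I_n -> T}) :
  \prod_k (f k == g k)%:R = (f == g)%:R :> C.
Proof.
have [->|nfg] := eqVneq f g; first by rewrite big1// => k _; rewrite eqxx.
have [k nk] : exists k, f k != g k.
  by apply/existsP; rewrite -negb_forall; apply: contra nfg => /forallP h;
    apply/eqP/ffunP => k; apply/eqP.
by rewrite (bigD1 k) //= (negPf nk) mul0r.
Qed.

Lemma tpow_psi_plus n x y :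
  tpow (@psi_plus R) n x y = (2^-1) ^+ n * (x.1 == x.2)%:R * (y.1 == y.2)%:R.
Proof.
rewrite -!prod_delta -[n in _ ^+ n]card_ord -prodr_const -!big_split; apply: eq_bigr => k _ /=.
by rewrite /psi_plus /=; do 2 case: eqP => _; rewrite ?mulr1 ?mulr0 ?mul0r.
Qed.

Lemma sum_delta2 (T : finType) (F : T * T -> C) :
  \sum_p F p * (p.1 == p.2)%:R = \sum_z F (z, z).
Proof.
rewrite sum_pair; apply: eq_bigr => z _ /=.
by under eq_bigr do rewrite mulrC; rewrite sum_delta.
Qed.

(** The resource is the projector on the sum of the |z z>, scaled by 2 ^ -n, so a product Kraus
    operator leaves a rank-one matrix. *)
Lemma sandw_psi_plus n (A' B' : finType) (K : mat A' (qubits n))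
   (L : mat B' (qubits n)) x y :
  sandw (kron K L) (tpow psi_plus n) x y =
  (2^-1) ^+ n * (\sum_z K x.1 z * L x.2 z) * conjc (\sum_z K y.1 z * L y.2 z).
Proof.
rewrite sandwE rmorph_sum /=.
transitivity ((2^-1) ^+ n * (\sum_i kron K L x i * (i.1 == i.2)%:R) *
   (\sum_j conjc (kron K L y j) * (j.1 == j.2)%:R)).
  rewrite -mulrA mulr_suml mulr_sumr; apply: eq_bigr => i _.
  rewrite !mulr_sumr; apply: eq_bigr => j _; rewrite tpow_psi_plus; ring.
by rewrite !sum_delta2.
Qed.

Lemma tp_idm (T : finType) : tp_kraus (fun _ : unit => @idm R T).
Proof. by move=> x y; rewrite sum_unit unitary_idm. Qed.

(* Alice's Kraus operator for the outcome [q] prepares [omega], of which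
   [phi] are the unnormalised pure components, on [A'] and a copy of Bob's
   system, and projects that copy jointly with her half of the resource on the
   maximally entangled vector rotated by [pauli q]; Bob undoes [pauli q]. *)
Lemma teleportation n (A' B' S : finType) (omega : bop R A' B')
    (phi : S -> A' * B' -> C) (J : B' -> qubits n) (b0 : B') :
  injective J -> trm omega = 1 ->
  (forall x y, omega x y = \sum_s phi s x * conjc (phi s y)) ->
  exists2 Lam : bop R (qubits n) (qubits n) -> bop R A' B',
    LOCC Lam & Lam (tpow psi_plus n) = omega.
Proof.
move=> Jinj omega1 homega.
(* The twirl contributes a factor 2 ^ n to the sum of Alice's effects, which c * c = 2 ^ -n
   cancels. *)
pose c : C := (Num.sqrt ((2^-1) ^+ n))%:C.
have cc : c * c = (2^-1) ^+ n.
  rewrite /c -rmorphM -expr2 sqr_sqrtr ?exprn_ge0 ?invr_ge0//.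
  by rewrite rmorphXn fmorphV rmorph_nat.
have cJ : conjc c = c by exact: conjc_real.
pose U q y z : C := (@pauli n q y z)%:C.
have UJ q y z : conjc (U q y z) = U q y z by exact: conjc_real.
have Ucol q z z' : \sum_y U q y z * U q y z' = (z == z')%:R.
  rewrite -[RHS](rmorph_nat (real_complex R)) -(pauli_col q) rmorph_sum.
  by apply: eq_bigr => y _; rewrite rmorphM.
have Urow q y y' : \sum_z U q y z * U q y' z = (y == y')%:R.
  rewrite -[RHS](rmorph_nat (real_complex R)) -(pauli_row q) rmorph_sum.
  by apply: eq_bigr => z _; rewrite rmorphM.
have Utw y y' z z' : \sum_q U q y z * U q y' z' = 2 ^+ n * (y == y')%:R * (z == z')%:R.
  transitivity ((2 ^+ n * (y == y')%:R * (z == z')%:R : R)%:C); last first.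
    by rewrite !rmorphM rmorphXn /= !rmorph_nat.
  by rewrite -pauli_twirl rmorph_sum; apply: eq_bigr => q _; rewrite rmorphM.
pose K q s : mat A' (qubits n) := fun a z => c * \sum_b phi s (a, b) * U q (J b) z.
(* [J] need not be onto. The operators indexed by [inr y] send what falls outside its range to [b0],
   which makes Bob's correction trace preserving; [KS] shows that they contribute nothing to the
   output. *)
pose L q (j : unit + qubits n) : mat B' (qubits n) := fun b z =>
  if j is inr y then (y \notin codom J)%:R * (b == b0)%:R * U q y z else U q (J b) z.
have tpL q : tp_kraus (L q).
  move=> z z'; rewrite /idm -(Ucol q) /mulm /adjm big_sumType sum_unit /=.
  rewrite [RHS](bigID (mem (codom J))) /=; congr (_ + _).
    rewrite -big_uniq /=; last by rewrite map_inj_uniq ?enum_uniq.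
    by rewrite [RHS]big_image; apply: eq_bigr => b _; rewrite oppr0.
  rewrite [RHS]big_mkcond /=; apply: eq_bigr => y _.
  transitivity (\sum_b (b0 == b)%:R * ((y \notin codom J)%:R * (U q y z * U q y z'))).
    apply: eq_bigr => b _; rewrite !conjcM !conjc_nat UJ [b0 == _]eq_sym.
    by case: (b == b0); case: (_ \notin _); rewrite ?(mulr1n, mulr0n); ring.
  by rewrite sum_delta; case: ifP => _; rewrite ?mul1r ?mul0r.
(* The twirl forces b = b' through the injectivity of [J]; what remains is the trace of [omega]
   times the identity. *)
have tpK : tp_kraus (fun qs : (qubits n * qubits n) * S => K qs.1 qs.2).
  move=> z z'; rewrite sum_pair /=.
  transitivity (\sum_s \sum_a \sum_b \sum_b' c * c * (conjc (phi s (a, b)) * phi s (a, b')) *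
     \sum_q U q (J b) z * U q (J b') z').
    under [RHS]eq_bigr => s _ do under eq_bigr => a _ do under eq_bigr => b _ do
      under eq_bigr => b' _ do rewrite mulr_sumr.
    under [RHS]eq_bigr => s _ do under eq_bigr => a _ do under eq_bigr => b _ do
      rewrite exchange_big /=.
    under [RHS]eq_bigr => s _ do under eq_bigr => a _ do rewrite exchange_big /=.
    under [RHS]eq_bigr => s _ do rewrite exchange_big /=.
    rewrite exchange_big /=; apply: eq_bigr => s _; apply: eq_bigr => q _.
    apply: eq_bigr => a _; rewrite /adjm /K conjcM cJ rmorph_sum mulrACA mulr_suml mulr_sumr.
    apply: eq_bigr => b _; rewrite !mulr_sumr; apply: eq_bigr => b' _ /=.
    by rewrite conjcM UJ; ring.
  have nn : c * c * 2 ^+ n = 1 by rewrite cc -exprMn mulVf ?expr1n ?pnatr_eq0.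
  transitivity ((\sum_s \sum_a \sum_b phi s (a, b) * conjc (phi s (a, b))) * (z == z')%:R).
    rewrite !mulr_suml; apply: eq_bigr => s _; rewrite mulr_suml; apply: eq_bigr => a _.
    rewrite mulr_suml; apply: eq_bigr => b _.
    transitivity (\sum_b' (b == b')%:R * (conjc (phi s (a, b)) * phi s (a, b') * (z == z')%:R)).
      apply: eq_bigr => b' _; rewrite Utw (inj_eq Jinj) -[RHS]mul1r -[X in _ = X * _]nn; ring.
    by rewrite sum_delta; ring.
  rewrite /idm -[RHS]mul1r -omega1; congr (_ * _).
  rewrite /trm sum_pair exchange_big; apply: eq_bigr => a _ /=.
  by rewrite exchange_big; apply: eq_bigr => b _ /=; rewrite homega.
pose Psi q (X : bop R A' (qubits n)) : bop R A' B' := fun x y =>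
  \sum_(i : unit) \sum_j sandw (kron (idm A') (L q j)) X x y.
exists (fun X x y => \sum_q Psi q (fun u v =>
    \sum_s sandw (kron (K q s) (idm (qubits n))) X u v) x y).
  by apply: LOCC_Alice => // q; apply: LOCC_local => //; exact: tp_idm.
apply/funext => x; apply/funext => y.
have KL q s b' a : \sum_z K q s a z * U q b' z = c * \sum_b phi s (a, b) * (J b == b')%:R.
  rewrite mulr_sumr.
  under [RHS]eq_bigr do rewrite -(Urow q) !mulr_sumr.
  rewrite [RHS]exchange_big; apply: eq_bigr => z _ /=.
  by rewrite /K mulrAC mulr_sumr; apply: eq_bigr => b _; ring.
have KN q s x' : \sum_z K q s x'.1 z * L q (inl tt) x'.2 z = c * phi s x'.
  rewrite KL; under eq_bigr do rewrite (inj_eq Jinj) mulrC eq_sym.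
  by rewrite sum_delta; case: x'.
have KS q s w x' : \sum_z K q s x'.1 z * L q (inr w) x'.2 z = 0.
  under eq_bigr do rewrite /L mulrCA.
  rewrite -mulr_sumr KL; case: (boolP (w \in codom J)) => [|hw]; first by rewrite !mul0r.
  rewrite big1 ?mulr0// => b _; case: eqP => [e|]; last by rewrite mulr0.
  by move: hw; rewrite -e codom_f.
rewrite homega.
(* After the correction each of the 4 ^ n outcomes leaves the same matrix, namely [omega] with
   weight 4 ^ -n. *)
transitivity (\sum_(q : qubits n * qubits n) (2^-1) ^+ n * (2^-1) ^+ n *
    \sum_s phi s x * conjc (phi s y)).
  apply: eq_bigr => q _; rewrite /Psi sum_unit big_sumType sum_unit /= [X in _ + X]big1 => [|w _].
    rewrite addr0 sandw_sum mulr_sumr; apply: eq_bigr => s _.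
    rewrite -sandw_mulm mulm_kron mulm1 mul1m sandw_psi_plus !KN conjcM cJ -cc; ring.
  rewrite sandw_sum big1// => s _.
  by rewrite -sandw_mulm mulm_kron mulm1 mul1m sandw_psi_plus KS mulr0 mul0r.
rewrite sumr_const card_prod card_ffun !card_ord -[LHS]mulr_natr natrM natrX.
set t := \sum_s _; have nn : (2^-1) ^+ n * 2 ^+ n = 1 :> C.
  by rewrite -exprMn mulVf ?expr1n ?pnatr_eq0.
by rewrite -[RHS]mul1r -[RHS]mul1r -[X in _ = X * (X * _)]nn; ring.
Qed.

End Teleportation.

(** * A positive rate from [psi_plus] to any state *)

Section FiniteCost.
Variable R : realType.
Local Notation C := R[i].
Local Notation mat := (mat R).

Lemma injection_of_card (T U : finType) : (#|T| <= #|U|)%N ->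
  exists f : T -> U, injective f.
Proof.
move=> h; exists (fun x => enum_val (widen_ord h (enum_rank x))) => x y.
by move=> /enum_val_inj/(congr1 val)/= /val_inj/enum_rank_inj.
Qed.

Lemma cvg_divn (l : nat) : (0 < l)%N ->
  (fun n => (n %/ l)%:R / n%:R : R) @ \oo --> (l%:R^-1 : R).
Proof.
move=> l0.
have inv0 : (fun n => (n%:R : R)^-1) @ \oo --> (0 : R).
  apply/gtr0_cvgV0; last exact: cvgr_idn.
  by near=> n; rewrite ltr0n; near: n; exact: nbhs_infty_gt.
have h : (fun n => l%:R^-1 - (n%:R : R)^-1) @ \oo --> (l%:R^-1 : R).
  by rewrite -[X in _ --> X]subr0; apply: cvgB => //; exact: cvg_cst.
apply: (squeeze_cvgr _ h (cvg_cst _)).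
near=> n; have n0 : (0 < n)%N by near: n; exact: nbhs_infty_gt.
have l0' : (0 : R) < l%:R by rewrite ltr0n.
have n0' : (0 : R) < n%:R by rewrite ltr0n.
have e : n%:R = (n %/ l)%:R * l%:R + (n %% l)%:R :> R by rewrite -natrM -natrD -divn_eq.
have m1 : (n %% l)%:R < l%:R :> R by rewrite ltr_nat ltn_mod.
have m0 : 0 <= (n %% l)%:R :> R by rewrite ler0n.
apply/andP; split.
  rewrite lerBlDr -[X in _ + X]mul1r -mulrDl ler_pdivlMr// mulrC ler_pdivrMr//.
  by rewrite mulrDl mul1r {1}e lerD2l ltW.
rewrite ler_pdivrMr// mulrC ler_pdivlMr// {1}e.
by rewrite lerDl.
Unshelve. all: by end_near. Qed.

(** The rate 1 / #|B| is crude but achieved with zero error: #|B| <= 2 ^ #|B|, so Bob's share of n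
    %/ #|B| copies fits into [n] qubits and is teleported exactly. *)
Lemma rate_psi_plus_gt0 (A B : finType) (rho : bop R A B) :
  is_state rho -> (0 < rate psi_plus rho)%E.
Proof.
move=> [prho rho1]; have [phi hphi] := psd_rank1 prho.
have [[a0 b0]] := trm1_inhabited rho1.
pose l := #|B|; have l0 : (0 < l)%N by apply/card_gt0P; exists b0.
have : (0 < l%:R^-1 :> R) by rewrite invr_gt0 ltr0n.
rewrite -lte_fin => /lt_le_trans; apply; apply: ereal_sup_ubound.
exists l%:R^-1 => //; split; first by rewrite invr_ge0.
have tele n : exists Lam : bop R {ffun 'I_n -> 'I_2} {ffun 'I_n -> 'I_2} ->
      bop R {ffun 'I_(n %/ l) -> A} {ffun 'I_(n %/ l) -> B},
    LOCC Lam /\ Lam (tpow psi_plus n) = tpow rho (n %/ l).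
  have [J Jinj] : exists J : {ffun 'I_(n %/ l) -> B} -> {ffun 'I_n -> 'I_2}, injective J.
    apply: injection_of_card; rewrite !card_ffun !card_ord.
    apply: (@leq_trans ((2 ^ l) ^ (n %/ l))); first by
      case: (n %/ l)%N => [//|k]; rewrite leq_exp2r// ltnW// ltn_expl.
    by rewrite -expnM leq_exp2l// mulnC leq_trunc_div.
  have [] := @teleportation R n _ _ {ffun 'I_(n %/ l) -> A * B} (tpow rho (n %/ l))
    (fun s x => \prod_k phi (s k) (x.1 k, x.2 k)) J [ffun=> b0] Jinj.
  - by rewrite trm_tpow rho1 expr1n.
  - move=> x y; rewrite /tpow; under eq_bigr do rewrite hphi.
    rewrite bigA_distr_bigA; apply: eq_bigr => s _.
    by rewrite big_split rmorph_prod.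
  by move=> Lam h1 h2; exists Lam.
have /(_ _)/cid tele' := tele.
exists (fun n => (n %/ l)%N), (fun n => projT1 (tele' n)); split => [n|].
  by case: (tele' n) => Lam [].
split; first exact: cvg_divn.
under eq_fun => n.
  rewrite (_ : projT1 _ _ = tpow rho (n %/ l)); last by case: (tele' n) => Lam [].
  rewrite tnorm_subm_refl; over.
exact: cvg_cst.
Qed.

End FiniteCost.

(** * Informationally complete local measurements *)

Section Frames.
Variable R : realType.
Local Notation C := R[i].
Local Notation mat := (mat R).

(** A Parseval frame: the rank-one operators |v_x><v_x| add up to the identity, so they form a
    measurement. *)
Definition tight (X T : finType) (v : X -> T -> C) :=
  forall a a', \sum_x v x a * conjc (v x a') = (a == a')%:R.

Definition amp (X T : finType) (v : X -> T -> C) (x : X) (a : T -> C) : C :=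
  \sum_i conjc (a i) * v x i.

Lemma tight_nrm (X T : finType) (v : X -> T -> C) a : tight v ->
  \sum_x sqn (amp v x a) = nrm a.
Proof.
move=> hv; apply: complexI; rewrite rmorph_sum -qf_idm /=.
transitivity (\sum_i \sum_j conjc (a i) * a j * \sum_x v x i * conjc (v x j)).
  under [RHS]eq_bigr do under eq_bigr do rewrite mulr_sumr.
  under [RHS]eq_bigr do rewrite exchange_big.
  rewrite [RHS]exchange_big; apply: eq_bigr => x _ /=.
  rewrite -mulcJ /amp rmorph_sum mulr_suml; apply: eq_bigr => i _ /=.
  by rewrite mulr_sumr; apply: eq_bigr => j _; rewrite rmorphM /= conjcK; ring.
by apply: eq_bigr => i _; apply: eq_bigr => j _; rewrite hv /idm mulrAC.
Qed.

Lemma ampZ (X T : finType) (v : X -> T -> C) x (r : R) a :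
  sqn (amp v x (fun i => r%:C * a i)) = r ^+ 2 * sqn (amp v x a).
Proof.
rewrite -sqn_real -sqnM; congr sqn; rewrite /amp mulr_sumr; apply: eq_bigr => i _.
by rewrite mulrA; congr (_ * _); rewrite -[r%:C in RHS]conjc_real; exact: rmorphM.
Qed.

Lemma nrmZ (T : finType) (r : R) (a : T -> C) :
  nrm (fun i => r%:C * a i) = r ^+ 2 * nrm a.
Proof. by rewrite /nrm mulr_sumr; apply: eq_bigr => i _; rewrite sqnM sqn_real. Qed.

Definition pvec (A B : finType) (a : A -> C) (b : B -> C) : A * B -> C :=
  fun p => a p.1 * b p.2.

Definition ci : C := 'i.

(* Phases i^s: averaging over s isolates the off-diagonal term (polarisation). *)
Definition polar_vec (T : finType) (x : T * T * 'I_4) (a : T) : C :=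
  (Num.sqrt ((8 * #|T|)%:R^-1))%:C * ((a == x.1.1)%:R + ci ^+ x.2 * (a == x.1.2)%:R).

Lemma sqrt_inv_sqr (n : nat) :
  (Num.sqrt (n%:R^-1 : R))%:C * (Num.sqrt (n%:R^-1 : R))%:C = n%:R^-1 :> C.
Proof.
rewrite -rmorphM -expr2 sqr_sqrtr ?invr_ge0//.
by rewrite fmorphV rmorph_nat.
Qed.

Lemma conjc_ci : conjc ci = - ci.
Proof. by congr Complex; rewrite oppr0. Qed.

Lemma ci_sqr : ci * ci = -1.
Proof. by rewrite -expr2 sqr_i. Qed.

Lemma conjc_ciX s : conjc (ci ^+ s) = (- ci) ^+ s :> C.
Proof. by rewrite -conjc_ci; exact: rmorphXn. Qed.

Lemma polar_sum (p q p' q' : C) :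
  \sum_(s < 4) (p + ci ^+ s * q) * (p' + conjc (ci ^+ s) * q') = 4 * (p * p' + q * q').
Proof.
under eq_bigr do rewrite conjc_ciX.
move: ci ci_sqr => z zz; rewrite !big_ord_recr big_ord0 /= !(exprS, expr0).
transitivity (p * p' * 4 + q * q' * (1 - z * z + z * z * (z * z) -
  z * z * (z * z) * (z * z)) + (p * q') * (1 - z + z * z - z * z * z) +
  q * p' * (1 + z + z * z + z * z * z)); first by ring.
by rewrite !zz; ring.
Qed.

(** The weight i^s cancels the phase of exactly one of the four products; the others sum to zero
    over the fourth roots of unity. *)
Lemma polar_sum_phase (p q p' q' : C) :
  \sum_(s < 4) ci ^+ s * ((p + conjc (ci ^+ s) * q) * (p' + ci ^+ s * q')) = 4 * (q * p').
Proof.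
under eq_bigr do rewrite conjc_ciX.
move: ci ci_sqr => z zz; rewrite !big_ord_recr big_ord0 /= !(exprS, expr0).
transitivity (p * p' * (1 + z + z * z + z * z * z) +
   q * p' * (1 - z * z + z * z * (z * z) - z * z * (z * z) * (z * z)) +
   p * q' * (1 + z * z + z * z * (z * z) + z * z * (z * z) * (z * z)) +
   q * q' * (1 - z * z * z + (z * z) * (z * z) * (z * z) -
   (z * z) * (z * z) * (z * z) * (z * z) * z)); first by ring.
by rewrite !zz; ring.
Qed.

(** Origin of the normalisation 8 #|T|: the four phases give a factor 4 and remove the cross terms,
    and each of the two remaining diagonal terms is repeated #|T| times by the free index. *)
Lemma tight_polar_vec (T : finType) : tight (@polar_vec T).
Proof.
move=> a a'; rewrite !sum_pair.
have T0 : (#|T|%:R != 0 :> C) by rewrite pnatr_eq0 -lt0n; apply/card_gt0P; exists a.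
transitivity (\sum_i \sum_j (8 * #|T|)%:R^-1 * (4 * ((i == a)%:R * (i == a')%:R) +
   4 * ((j == a)%:R * (j == a')%:R)) : C).
  apply: eq_bigr => i _; apply: eq_bigr => j _; rewrite -mulrDr -polar_sum mulr_sumr.
  apply: eq_bigr => s _; rewrite /polar_vec /= -sqrt_inv_sqr.
  set t := _%:C; have tJ : conjc t = t by exact: conjc_real.
  by rewrite !(conjcM,conjcD) tJ !conjc_nat ![_ == a]eq_sym ![_ == a']eq_sym; ring.
have e : \sum_(i : T) 4 * ((i == a)%:R * (i == a')%:R) = 4 * (a == a')%:R :> C.
  rewrite -mulr_sumr; congr (_ * _); rewrite -[RHS](sum_delta a (fun i => (i == a')%:R)).
  by apply: eq_bigr => i _; rewrite [a == i]eq_sym.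
under eq_bigr do rewrite -mulr_sumr big_split /= e sumr_const.
transitivity ((8 * #|T|)%:R^-1 * ((4 * (a == a')%:R) *+ #|T| + (4 * (a == a')%:R) *+ #|T|) : C).
  by rewrite -mulr_sumr big_split /= sumrMnl e sumr_const.
by rewrite -mulrnDl -[X in _ * X = _]mulr_natr natrM; field.
Qed.

Lemma qf_pvec (A B : finType) (X : bop R A B) (a : A -> C) (b : B -> C) :
  qf X (pvec a b) = \sum_i \sum_j \sum_k \sum_l
    (conjc (a i) * a k) * (conjc (b j) * b l) * X (i, j) (k, l).
Proof.
rewrite /qf sum_pair; apply: eq_bigr => i _; apply: eq_bigr => j _.
rewrite sum_pair; apply: eq_bigr => k _; apply: eq_bigr => l _.
by rewrite /pvec rmorphM /=; ring.
Qed.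

(** Informational completeness: weighting the outcomes by the phases on both sides isolates a single
    matrix entry, up to a nonzero constant. *)
Lemma polar_vec_determine (A B : finType) (X : bop R A B) :
  (forall x y, qf X (pvec (@polar_vec A x) (@polar_vec B y)) = 0) ->
  forall i j, X i j = 0.
Proof.
move=> h [j l] [i k].
have A0 : (8 * #|A|)%:R != 0 :> C.
  by rewrite pnatr_eq0 muln_eq0 /= -lt0n; apply/card_gt0P; exists i.
have B0 : (8 * #|B|)%:R != 0 :> C.
  by rewrite pnatr_eq0 muln_eq0 /= -lt0n; apply/card_gt0P; exists k.
have pol (T : finType) (p q a a' : T) :
    \sum_(s < 4) ci ^+ s * (conjc (polar_vec (p, q, s) a) * polar_vec (p, q, s) a')
    = (8 * #|T|)%:R^-1 * 4 * ((q == a)%:R * (p == a')%:R).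
  rewrite -mulrA [p == _]eq_sym [q == _]eq_sym.
  rewrite -(polar_sum_phase (a == p)%:R (a == q)%:R (a' == p)%:R (a' == q)%:R) mulr_sumr.
  apply: eq_bigr => s _; rewrite /polar_vec /= -sqrt_inv_sqr.
  set t := _%:C; have tJ : conjc t = t by exact: conjc_real.
  by rewrite !(conjcM,conjcD) tJ !conjc_nat; ring.
have : \sum_(s < 4) \sum_(t < 4) ci ^+ s * ci ^+ t *
    qf X (pvec (polar_vec (i, j, s)) (polar_vec (k, l, t))) = 0.
  by apply: big1 => s _; apply: big1 => t _; rewrite h mulr0.
have -> : \sum_(s < 4) \sum_(t < 4) ci ^+ s * ci ^+ t *
    qf X (pvec (polar_vec (i, j, s)) (polar_vec (k, l, t))) =
   \sum_a \sum_b \sum_a' \sum_b'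
     (\sum_(s < 4) ci ^+ s * (conjc (polar_vec (i, j, s) a) * polar_vec (i, j, s) a')) *
     (\sum_(t < 4) ci ^+ t * (conjc (polar_vec (k, l, t) b) * polar_vec (k, l, t) b')) *
     X (a, b) (a', b').
  under [RHS]eq_bigr do under eq_bigr do under eq_bigr do under eq_bigr do
    (rewrite mulr_suml mulr_suml; under eq_bigr do rewrite mulr_sumr mulr_suml).
  under [RHS]eq_bigr do under eq_bigr do under eq_bigr do
    (rewrite exchange_big /=; under eq_bigr do rewrite exchange_big /=).
  under [RHS]eq_bigr do under eq_bigr do 
    (rewrite exchange_big /=; under eq_bigr do rewrite exchange_big /=).
  under [RHS]eq_bigr do 
    (rewrite exchange_big /=; under eq_bigr do rewrite exchange_big /=).
  rewrite [RHS]exchange_big /=; apply: eq_bigr => s _.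
  rewrite [RHS]exchange_big /=; apply: eq_bigr => t _.
  rewrite qf_pvec mulr_sumr; apply: eq_bigr => a _.
  rewrite mulr_sumr; apply: eq_bigr => b _.
  rewrite mulr_sumr; apply: eq_bigr => a' _.
  rewrite mulr_sumr; apply: eq_bigr => b' _; ring.
under eq_bigr do under eq_bigr do under eq_bigr do under eq_bigr do rewrite !pol.
have -> : \sum_a \sum_b \sum_a' \sum_b' (8 * #|A|)%:R^-1 * 4 * ((j == a)%:R * (i == a')%:R) *
     ((8 * #|B|)%:R^-1 * 4 * ((l == b)%:R * (k == b')%:R)) * X (a, b) (a', b') =
   \sum_a (j == a)%:R * \sum_b (l == b)%:R * \sum_a' (i == a')%:R * \sum_b' (k == b')%:R *
     ((8 * #|A|)%:R^-1 * 4 * ((8 * #|B|)%:R^-1 * 4) * X (a, b) (a', b')).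
  apply: eq_bigr => a _; rewrite mulr_sumr; apply: eq_bigr => b _; rewrite 2!mulr_sumr.
  apply: eq_bigr => a' _; rewrite 3!mulr_sumr; apply: eq_bigr => b' _; ring.
rewrite !sum_delta => /eqP; rewrite !mulf_eq0 !invr_eq0 (negPf A0) (negPf B0).
by rewrite pnatr_eq0 /= => /eqP.
Qed.

End Frames.

(** * Separating an entangled state from product vectors *)

Section Witness.
Variable R : realType.
Local Notation C := R[i].
Local Notation mat := (mat R).

Lemma cont_add (T : topologicalType) (f g : T -> R) : continuous f -> continuous g ->
  continuous (fun x => f x + g x).
Proof. by move=> cf cg x; exact: (cvgD (cf x) (cg x)). Qed.

Lemma cont_mul (T : topologicalType) (f g : T -> R) : continuous f -> continuous g ->
  continuous (fun x => f x * g x).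
Proof. by move=> cf cg x; exact: (cvgM (cf x) (cg x)). Qed.

Lemma cont_opp (T : topologicalType) (f : T -> R) : continuous f -> continuous (fun x => - f x).
Proof. by move=> cf x; exact: (cvgN (cf x)). Qed.

Lemma cont_cst (T : topologicalType) (c : R) : continuous (fun _ : T => c).
Proof. by move=> x; exact: cvg_cst. Qed.

Lemma cont_sum (T : topologicalType) (J : finType) (f : J -> T -> R) :
  (forall j, continuous (f j)) -> continuous (fun x => \sum_j f j x).
Proof.
move=> cf; elim: (index_enum J) => [|j s IH].
  by under eq_fun do rewrite big_nil; exact: cont_cst.
by under eq_fun do rewrite big_cons; exact: cont_add.
Qed.

(** Continuity by real and imaginary parts, matching the real coordinates in which mixtures are
    parametrised below. *)
Definition ccont (T : topologicalType) (f : T -> C) :=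
  continuous (fun x => Re (f x)) /\ continuous (fun x => Im (f x)).

Lemma ccont_sqn (T : topologicalType) (f : T -> C) : ccont f ->
  continuous (fun x => sqn (f x)).
Proof.
move=> [h1 h2]; under eq_fun do rewrite /sqn !expr2.
by apply: cont_add; apply: cont_mul.
Qed.

Lemma ccont_sum (T : topologicalType) (J : finType) (f : J -> T -> C) :
  (forall j, ccont (f j)) -> ccont (fun x => \sum_j f j x).
Proof.
move=> cf; split.
  by under eq_fun do rewrite Re_sum; apply: cont_sum => j; exact: (cf j).1.
by under eq_fun do rewrite Im_sum; apply: cont_sum => j; exact: (cf j).2.
Qed.

Lemma ccont_conjM (T : topologicalType) (f : T -> C) (c : C) : ccont f ->
  ccont (fun x => conjc (f x) * c).
Proof.
move=> [h1 h2]; case: c => c d.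
have eR x : Re (conjc (f x) * Complex c d) = Re (f x) * c + Im (f x) * d.
  by case: (f x) => p q /=; rewrite mulNr opprK.
have eI x : Im (conjc (f x) * Complex c d) = Re (f x) * d + - Im (f x) * c.
  by case: (f x).
split; [under eq_fun do rewrite eR|under eq_fun do rewrite eI];
  apply: cont_add; apply: cont_mul => //; try exact: cont_cst.
exact: cont_opp.
Qed.

Section Mixtures.
Variables (A B X Y : finType) (v : X -> A -> C) (u : Y -> B -> C).
Hypotheses (tight_v : tight v) (tight_u : tight u).

Definition pprob (a : A -> C) (b : B -> C) (z : X * Y) : R :=
  sqn (amp v z.1 a) * sqn (amp u z.2 b).

Lemma pprob_sum a b : \sum_z pprob a b z = nrm a * nrm b.
Proof.
rewrite sum_pair -(tight_nrm a tight_v) -(tight_nrm b tight_u) mulr_suml.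
by apply: eq_bigr => x _; rewrite mulr_sumr.
Qed.

Lemma pprobZ r a b z : pprob (fun i => r%:C * a i) b z = r ^+ 2 * pprob a b z.
Proof. by rewrite /pprob ampZ mulrA. Qed.

(** A mixture of [K] product vectors. The weight of a term is the squared norm of its first vector,
    the second being a unit vector in [normalised], so a zero first vector is a free slot. *)
Definition mixt K := 'I_K -> (A -> C) * (B -> C).

Definition mprob K (th : mixt K) (z : X * Y) : R :=
  \sum_k pprob (th k).1 (th k).2 z.

Definition normalised K (th : mixt K) :=
  \sum_k nrm (th k).1 = 1 /\ forall k, nrm (th k).2 = 1.

(* One Caratheodory step: more than [#|X * Y|] outcome vectors are linearly
   dependent, and moving along the dependency kills one of the weights. *)
Lemma caratheodory_step (th : mixt #|{: X * Y}|.+1) : normalised th ->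
  exists th' : mixt #|{: X * Y}|.+1, [/\ normalised th',
    mprob th' =1 mprob th & exists k, forall i, (th' k).1 i = 0].
Proof.
move=> [th1 th2]; set N := #|_|.
pose M : 'M[R]_(N.+1, N) := \matrix_(k, j) pprob (th k).1 (th k).2 (enum_val j).
have : kermx M != 0.
  rewrite -mxrank_eq0 mxrank_ker -lt0n subn_gt0 ltnS; exact: rank_leq_col.
case/rowV0Pn => c /sub_kermxP cM c0.
have cP z : \sum_k c 0 k * pprob (th k).1 (th k).2 z = 0.
  have /rowP/(_ (enum_rank z)) := cM; rewrite !mxE => h.
  by rewrite -[RHS]h; apply: eq_bigr => k _; rewrite mxE enum_rankK.
(* Outcome probabilities of a term add up to its weight, so the dependency also preserves the total
   weight. *)
have cn : \sum_k c 0 k * nrm (th k).1 = 0.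
  transitivity (\sum_k \sum_z c 0 k * pprob (th k).1 (th k).2 z).
    by apply: eq_bigr => k _; rewrite -mulr_sumr pprob_sum th2 mulr1.
  by rewrite exchange_big big1.
(* With |c_i| maximal every factor 1 - c_k / c_i is non-negative, and it vanishes at k = i. Vectors
   are scaled by its square root because weights are squared norms. *)
pose i := [arg max_(i > ord0 : 'I_N.+1) `|c 0 i|]%O.
have imax k : `|c 0 k| <= `|c 0 i|.
  by rewrite /i; case: arg_maxP => // j _ h; exact: h.
have ci0 : c 0 i != 0.
  apply: contra c0 => /eqP e; apply/eqP/rowP => k; rewrite mxE.
  by apply/eqP; rewrite -normr_le0 (le_trans (imax k))// e normr0.
have w0 k : 0 <= 1 - c 0 k / c 0 i.
  rewrite subr_ge0 (le_trans (ler_norm _))// normrM normfV ler_pdivrMr ?normr_gt0//.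
  by rewrite mul1r.
exists (fun k => ((fun a => (Num.sqrt (1 - c 0 k / c 0 i))%:C * (th k).1 a), (th k).2)).
have lin (F : 'I_N.+1 -> R) : \sum_k c 0 k * F k = 0 ->
    \sum_k Num.sqrt (1 - c 0 k / c 0 i) ^+ 2 * F k = \sum_k F k.
  move=> h; transitivity (\sum_k F k - (c 0 i)^-1 * \sum_k c 0 k * F k).
    rewrite mulr_sumr -sumrB; apply: eq_bigr => k _; rewrite sqr_sqrtr//; ring.
  by rewrite h mulr0 subr0.
split; last by exists i => a; rewrite /= divff// subrr sqrtr0 rmorph0 mul0r.
  split => //=; rewrite -[RHS]th1 -(lin (fun k => nrm (th k).1))//.
  by apply: eq_bigr => k _; rewrite nrmZ.
move=> z; rewrite /mprob -(lin (fun k => pprob (th k).1 (th k).2 z))//.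
by apply: eq_bigr => k _; rewrite pprobZ.
Qed.

Section Compactness.
Variable K : nat.
Let I : choiceType := ('I_K * ((A + B) * bool))%type.
Let par : topologicalType := prod_topology (fun _ : I => (R : topologicalType)).

Definition dec (f : par) : mixt K := fun k =>
  ((fun a => Complex (f (k, (inl a, true))) (f (k, (inl a, false)))),
   (fun b => Complex (f (k, (inr b, true))) (f (k, (inr b, false))))).

Definition enc (th : mixt K) : par := fun i =>
  let z := match i.2.1 with inl a => (th i.1).1 a | inr b => (th i.1).2 b end in
  if i.2.2 then Re z else Im z.

Lemma encK th : dec (enc th) = th.
Proof.
apply/funext => k; rewrite /dec /enc /=; case: (th k) => a b /=.
by congr (_, _); apply/funext => i; [case: (a i)|case: (b i)].
Qed.

Lemma cont_coord (i : I) : continuous (fun f : par => f i).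
Proof. exact: (@proj_continuous _ (fun _ : I => (R : topologicalType)) i). Qed.

Lemma ccont_decl k a : ccont (fun f => (dec f k).1 a).
Proof. by split; exact: cont_coord. Qed.

Lemma ccont_decr k b : ccont (fun f => (dec f k).2 b).
Proof. by split; exact: cont_coord. Qed.

Lemma cont_mprob z : continuous (fun f => mprob (dec f) z).
Proof.
apply: cont_sum => k; apply: cont_mul; apply: ccont_sqn; apply: ccont_sum => i;
  apply: ccont_conjM; [exact: ccont_decl|exact: ccont_decr].
Qed.

Lemma cont_nrml k : continuous (fun f => nrm (dec f k).1).
Proof. by apply: cont_sum => i; apply: ccont_sqn; exact: ccont_decl. Qed.

Lemma cont_nrmr k : continuous (fun f => nrm (dec f k).2).
Proof. by apply: cont_sum => i; apply: ccont_sqn; exact: ccont_decr. Qed.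

Lemma nrm_le1_coord (T : finType) (a : T -> C) i : nrm a <= 1 ->
  (-1 <= Re (a i) <= 1) /\ (-1 <= Im (a i) <= 1).
Proof.
move=> h; have : sqn (a i) <= 1.
  apply: le_trans h; rewrite /nrm (bigD1 i) //= lerDl sumr_ge0// => j _.
  exact: sqn_ge0.
rewrite /sqn => h2; have hr := sqr_ge0 (Re (a i)); have hi := sqr_ge0 (Im (a i)).
by rewrite -!ler_norml; split; rewrite -(@expr_le1 _ 2)// real_normK ?num_real//; lra.
Qed.

(** Normalised mixtures form a closed subset of a cube, compact by Tychonoff, on which the squared
    distance is continuous. *)
Lemma closest_mixture (p : X * Y -> R) :
  (exists th : mixt K, normalised th) ->
  exists2 th0 : mixt K, normalised th0 & forall th : mixt K, normalised th ->
    \sum_z (p z - mprob th0 z) ^+ 2 <= \sum_z (p z - mprob th z) ^+ 2.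
Proof.
move=> [th1 nth1].
pose box : set par := [set f | forall i, `[-1, 1]%classic (f i)].
pose cl : set par := [set f | normalised (dec f)].
have cbox : compact box.
  apply: (@tychonoff _ (fun _ : I => (R : topologicalType)) (fun=> `[-1, 1]%classic)).
  by move=> i; exact: segment_compact.
have ccl : closed cl.
  rewrite (_ : cl = [set f | \sum_k nrm (dec f k).1 = 1] `&`
     \bigcap_(k in [set: 'I_K]) [set f | nrm (dec f k).2 = 1]); last first.
    apply/seteqP; split => f /= [h1 h2]; split => // k; last exact: h2.
    by move=> _; exact: h2.
  apply: closedI.
    apply: (@preimage_closed par R (fun f : par => \sum_k nrm (dec f k).1) [set 1]).
      by move=> f _; apply: cont_sum => k; exact: cont_nrml.
    exact: closed_eq.
  apply: closed_bigI => k _.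
  apply: (@preimage_closed par R (fun f : par => nrm (dec f k).2) [set 1]).
    by move=> f _; exact: cont_nrmr.
  exact: closed_eq.
have subbox : cl `<=` box.
  move=> f [h1 h2] [k [j t]]; rewrite /= in_itv /=.
  have b1 : nrm (dec f k).1 <= 1.
    by rewrite -h1 (bigD1 k) //= lerDl sumr_ge0// => l _; exact: nrm_ge0.
  have b2 : nrm (dec f k).2 <= 1 by rewrite h2.
  case: j => [a|b].
    by have [] := nrm_le1_coord a b1; case: t.
  by have [] := nrm_le1_coord b b2; case: t.
have cc : compact cl.
  have -> : cl = box `&` cl by rewrite setIC; apply/esym/setIidPl.
  exact: compact_closedI.
pose D (f : par) := \sum_z (p z - mprob (dec f) z) ^+ 2.
have cD : continuous D.
  apply: cont_sum => z; under eq_fun do rewrite expr2.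
  by apply: cont_mul; apply: cont_add; [exact: cont_cst|apply: cont_opp; exact: cont_mprob|
    exact: cont_cst|apply: cont_opp; exact: cont_mprob].
have [] := @compact_EVT_min par R D cl.
- by exists (enc th1); rewrite /cl /= encK.
- exact: cc.
- by apply: continuous_subspaceT.
move=> f; rewrite inE => hf hmin; exists (dec f) => // th nth.
have := hmin (enc th); rewrite inE /D /= encK; apply.
by rewrite /cl /= encK.
Qed.

End Compactness.
End Mixtures.
End Witness.

(** * Projection onto the convex set of product distributions *)

Section EntanglementWitness.
Variable R : realType.
Local Notation C := R[i].
Local Notation mat := (mat R).

Lemma nrm_delta (T : finType) (t : T) : nrm (fun i => (i == t)%:R : C) = 1.
Proof.
rewrite /nrm (bigD1 t) //= eqxx sqn1 big1 ?addr0// => i /negPf ->.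
by rewrite sqn0.
Qed.

Lemma pprob_ge0 (A B X Y : finType) (v : X -> A -> C) (u : Y -> B -> C) a b z :
  0 <= pprob v u a b z.
Proof. by rewrite mulr_ge0 ?sqn_ge0. Qed.

Lemma pprobZr (A B X Y : finType) (v : X -> A -> C) (u : Y -> B -> C) r a b z :
  pprob v u a (fun i => r%:C * b i) z = r ^+ 2 * pprob v u a b z.
Proof. by rewrite /pprob ampZ mulrCA. Qed.

(** Projection onto a convex set: if [p] differs from its nearest point [q], the difference p - q
    separates them by the variational inequality for [q]. *)
Lemma mixture_or_witness (A B X Y : finType) (v : X -> A -> C) (u : Y -> B -> C)
    (a0 : A) (b0 : B) (p : X * Y -> R) :
  tight v -> tight u -> \sum_z p z = 1 ->
  (exists th : mixt R A B #|{: X * Y}|.+1, normalised th /\ mprob v u th =1 p) \/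
  (exists w : X * Y -> R, (forall a b, \sum_z w z * pprob v u a b z <= 0) /\
     0 < \sum_z w z * p z).
Proof.
move=> hv hu p1; set K := #|_|.+1.
have [|th0 nth0 min0] := @closest_mixture R A B X Y v u K p.
  exists (fun k => ((fun i => (k == ord0)%:R * (i == a0)%:R), (fun j => (j == b0)%:R))).
  split => [|k] /=; last exact: nrm_delta.
  rewrite (bigD1 ord0) //= big1 => [|k /negPf ->].
    rewrite addr0 -(nrm_delta a0); apply: eq_bigr => i _.
    by rewrite ?mulr1n mul1r.
  by rewrite /nrm big1// => i _; rewrite mul0r sqn0.
(* The freed slot [k0] lets a new product vector enter without lengthening the mixture, so
   minimality can be tested along segments. This is why mixtures have one term more than there are
   outcomes. *)
have [th1 [nth1 e1 [k0 hk0]]] := caratheodory_step hv hu nth0.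
pose q := mprob v u th1.
have minq (th : mixt R A B K) : normalised th ->
    \sum_z (p z - q z) ^+ 2 <= \sum_z (p z - mprob v u th z) ^+ 2.
  move=> nth; rewrite (eq_bigr (fun z => (p z - mprob v u th0 z) ^+ 2)); first exact: min0.
  by move=> z _; rewrite /q e1.
have q1 : \sum_z q z = 1.
  rewrite /q /mprob exchange_big /= -nth1.1; apply: eq_bigr => k _.
  by rewrite pprob_sum// nth1.2 mulr1.
have [w0|w0] := eqVneq (\sum_z (p z - q z) ^+ 2) 0.
  left; exists th1; split => // z.
  have /eqP : (p z - q z) ^+ 2 = 0.
    exact: (psumr_eq0P (fun z _ => sqr_ge0 (p z - q z)) w0).
  by rewrite sqrf_eq0 subr_eq0 => /eqP ->.
have {w0} w_gt0 : 0 < \sum_z (p z - q z) ^+ 2.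
  by rewrite lt_neqAle eq_sym w0 sumr_ge0// => z _; exact: sqr_ge0.
(* Since all distributions have total mass 1, subtracting the constant [beta] is the same as
   subtracting the value at [q]; the separating functional becomes linear with threshold 0. *)
right; pose beta := \sum_z (p z - q z) * q z.
exists (fun z => p z - q z - beta); split; last first.
  rewrite (_ : \sum_z _ = \sum_z (p z - q z) ^+ 2)//.
  under eq_bigr do rewrite mulrBl.
  rewrite sumrB -mulr_sumr p1 mulr1 /beta -sumrB; apply: eq_bigr => z _; ring.
have unit a b : nrm a = 1 -> nrm b = 1 ->
    \sum_z (p z - q z - beta) * pprob v u a b z <= 0.
  move=> na nb; set f := pprob v u a b.
  have f1 : \sum_z f z = 1 by rewrite pprob_sum// na nb mulr1.
  have -> : \sum_z (p z - q z - beta) * f z = \sum_z (p z - q z) * (f z - q z).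
    under eq_bigr do rewrite mulrBl.
    rewrite sumrB -mulr_sumr f1 mulr1 /beta -sumrB; apply: eq_bigr => z _; ring.
  set S1 := \sum_z _; pose S2 := \sum_z (f z - q z) ^+ 2.
  have S2_ge0 : 0 <= S2 by rewrite sumr_ge0// => z _; exact: sqr_ge0.
  (* Minimality of [q] compared with the point (1 - t) q + t f. *)
  have quad t : 0 <= t <= 1 -> 2 * t * S1 <= t ^+ 2 * S2.
    move=> /andP[t0 t1].
    have st : Num.sqrt (1 - t) ^+ 2 = 1 - t by rewrite sqr_sqrtr// subr_ge0.
    pose th k := if k == k0 then ((fun i => (Num.sqrt t)%:C * a i), b)
      else ((fun i => (Num.sqrt (1 - t))%:C * (th1 k).1 i), (th1 k).2).
    have nk0 : nrm (th1 k0).1 = 0 by rewrite /nrm big1// => i _; rewrite hk0 sqn0.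
    have pk0 z : pprob v u (th1 k0).1 (th1 k0).2 z = 0.
      by rewrite /pprob /amp big1 ?sqn0 ?mul0r// => i _; rewrite hk0 rmorph0 mul0r.
    have nth : normalised th.
      split => [|k]; last by rewrite /th; case: ifP => _ //; exact: nth1.2.
      rewrite (bigD1 k0) //= {1}/th eqxx /= nrmZ na mulr1 sqr_sqrtr//.
      rewrite (eq_bigr (fun k => (1 - t) * nrm (th1 k).1)); last first.
        by move=> k /negPf kk; rewrite /th kk /= nrmZ st.
      have := nth1.1; rewrite (bigD1 k0) //= nk0 add0r -mulr_sumr => ->; ring.
    have eth z : mprob v u th z = (1 - t) * q z + t * f z.
      rewrite /mprob (bigD1 k0) //= {1 2}/th eqxx /= pprobZ sqr_sqrtr// addrC; congr (_ + _).
      rewrite /q /mprob [in RHS](bigD1 k0) //= pk0 add0r mulr_sumr; apply: eq_bigr => k /negPf kk.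
      by rewrite /th kk /= pprobZ st.
    have := minq _ nth.
    have -> : \sum_z (p z - mprob v u th z) ^+ 2 =
        \sum_z (p z - q z) ^+ 2 - 2 * t * S1 + t ^+ 2 * S2.
      rewrite /S1 /S2 !mulr_sumr -sumrB -big_split; apply: eq_bigr => z _ /=.
      rewrite eth; ring.
    by lra.
  rewrite leNgt; apply/negP => S1_gt0.
  have s12 : 0 < S1 + S2 by lra.
  (* This value lies in (0, 1] and gives t S2 <= S1, whereas [quad] would give 2 S1 <= t S2. *)
  pose t := S1 / (S1 + S2).
  have t0 : 0 < t by rewrite divr_gt0.
  have t1 : t <= 1 by rewrite ler_pdivrMr//; lra.
  have tS : t * S2 <= S1.
    have : t * (S1 + S2) = S1 by rewrite divfK// gt_eqF.
    have := mulr_gt0 t0 S1_gt0; lra.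
  have := quad t; rewrite (ltW t0) t1 => /(_ isT).
  have -> : 2 * t * S1 = t * (2 * S1) by ring.
  rewrite expr2 -mulrA ler_pM2l//.
  by lra.
move=> a b.
(* Both sides are homogeneous: a zero vector has all probabilities zero, and any other pair is
   rescaled to unit vectors. *)
have [ab0|ab0] := eqVneq (nrm a * nrm b) 0.
  rewrite big1// => z _.
  have := pprob_sum hv hu a b; rewrite ab0 => h.
  by rewrite (psumr_eq0P (fun z _ => pprob_ge0 v u a b z) h) ?mulr0.
have [na nb] : 0 < nrm a /\ 0 < nrm b.
  move: ab0; rewrite mulf_eq0 negb_or => /andP[h1 h2].
  by rewrite !lt_neqAle ![0 == _]eq_sym h1 h2 !nrm_ge0.
pose ra := Num.sqrt (nrm a)^-1; pose rb := Num.sqrt (nrm b)^-1.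
have ra2 : ra ^+ 2 = (nrm a)^-1 by rewrite sqr_sqrtr// invr_ge0 ltW.
have rb2 : rb ^+ 2 = (nrm b)^-1 by rewrite sqr_sqrtr// invr_ge0 ltW.
have := unit (fun i => ra%:C * a i) (fun j => rb%:C * b j).
rewrite !nrmZ ra2 rb2 !mulVf ?gt_eqF// => /(_ erefl erefl).
under eq_bigr do rewrite pprobZ pprobZr ra2 rb2 mulrCA [X in _ * X]mulrCA.
rewrite -mulr_sumr -mulr_sumr !pmulr_rle0 ?invr_gt0//.
Qed.

Lemma qf_pvec_real (A B X Y : finType) (v : X -> A -> C) (u : Y -> B -> C) a b z :
  qf (fun i j => pvec a b i * conjc (pvec a b j)) (pvec (v z.1) (u z.2))
  = (pprob v u a b z)%:C.
Proof.
rewrite /pprob -sqnM -mulJc.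
have -> : amp v z.1 a * amp u z.2 b = \sum_i conjc (pvec a b i) * pvec (v z.1) (u z.2) i.
  rewrite sum_pair /amp mulr_suml; apply: eq_bigr => i _; rewrite mulr_sumr.
  by apply: eq_bigr => j _; rewrite /pvec rmorphM /=; ring.
rewrite rmorph_sum mulr_suml; apply: eq_bigr => i _; rewrite mulr_sumr /=.
by apply: eq_bigr => j _; rewrite [conjc (conjc _ * _)]rmorphM /= conjcK; ring.
Qed.

Lemma tight_trace (A B X Y : finType) (v : X -> A -> C) (u : Y -> B -> C) (M : bop R A B) :
  tight v -> tight u -> \sum_z qf M (pvec (v z.1) (u z.2)) = trm M.
Proof.
move=> hv hu; rewrite /qf exchange_big; apply: eq_bigr => i _ /=.
rewrite exchange_big (bigD1 i) //=.
have e j : \sum_z conjc (pvec (v z.1) (u z.2) i) * M i j * pvec (v z.1) (u z.2) j =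
    M i j * ((j.1 == i.1)%:R * (j.2 == i.2)%:R).
  rewrite -hv -hu mulr_suml mulr_sumr sum_pair; apply: eq_bigr => x _.
  rewrite !mulr_sumr; apply: eq_bigr => y _.
  by rewrite /pvec rmorphM /=; ring.
rewrite e !eqxx !mulr1 big1 ?addr0// => j ji.
by rewrite e -natrM mulnb -xpair_eqE -!surjective_pairing (negPf ji) mulr0.
Qed.

Lemma state_pure (T : finType) (a : T -> C) : nrm a = 1 ->
  is_state (fun i j => a i * conjc (a j)).
Proof.
move=> na; split => [w|]; last first.
  by rewrite /trm -nrmE na.
rewrite (_ : \sum_i _ = (sqn (\sum_i conjc (a i) * w i))%:C) ?ler0c ?sqn_ge0//.
rewrite -mulJc rmorph_sum mulr_suml; apply: eq_bigr => i _; rewrite mulr_sumr /=.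
by apply: eq_bigr => j _; rewrite rmorphM /= conjcK; ring.
Qed.

Lemma mixture_separable (A B : finType) K (th : mixt R A B K) (rho : bop R A B) :
  normalised th -> trm rho = 1 ->
  (forall i j, rho i j = \sum_k pvec (th k).1 (th k).2 i * conjc (pvec (th k).1 (th k).2 j)) ->
  separable rho.
Proof.
move=> [n1 n2] rho1 hrho.
have [[a0 b0]] := trm1_inhabited rho1.
(* A term of weight zero has no direction to normalise; an arbitrary basis vector stands in for
   it. *)
pose ua k i : C := if nrm (th k).1 == 0 then (i == a0)%:R else
  (Num.sqrt (nrm (th k).1)^-1)%:C * (th k).1 i.
exists K, (fun k => nrm (th k).1), (fun k i j => ua k i * conjc (ua k j)),
  (fun k i j => (th k).2 i * conjc ((th k).2 j)).
split; first by move=> k; exact: nrm_ge0.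
split => //; split => [k|x y].
  split; last exact: state_pure.
  apply: state_pure; rewrite /ua; case: eqP => [_|/eqP h]; first exact: nrm_delta.
  by rewrite nrmZ sqr_sqrtr ?invr_ge0 ?nrm_ge0// mulVf.
rewrite hrho; apply: eq_bigr => k _; rewrite complexr0 /kron /ua /pvec.
case: eqP => [h|/eqP h].
  have z i : (th k).1 i = 0.
    by apply: sqn_eq0; exact: (psumr_eq0P (fun i _ => sqn_ge0 ((th k).1 i)) h).
  by rewrite h !z rmorph0 !mul0r.
set r := Num.sqrt _; have rr : (nrm (th k).1)%:C * (r%:C * r%:C) = 1.
  by rewrite -rmorphM -expr2 sqr_sqrtr ?invr_ge0 ?nrm_ge0// -rmorphM mulfV.
have rJ : conjc r%:C = r%:C by exact: conjc_real.
rewrite !conjcM rJ -[LHS]mul1r -[X in X * _ = _]rr; ring.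
Qed.

Definition outcome (A B X Y : finType) (v : X -> A -> C) (u : Y -> B -> C)
  (M : bop R A B) (z : X * Y) : R := Re (qf M (pvec (v z.1) (u z.2))).

(** If a mixture reproduced the outcome distribution of [rho], informational completeness would make
    it equal to [rho], which would then be separable. *)
Lemma entangled_witness (A B : finType) (rho : bop R A B) : entangled rho ->
  exists (X Y : finType) (v : X -> A -> C) (u : Y -> B -> C) (w : X * Y -> R),
    [/\ tight v, tight u, forall a b, \sum_z w z * pprob v u a b z <= 0 &
        0 < \sum_z w z * outcome v u rho z].
Proof.
move=> [[prho rho1] nsep].
have [[a0 b0]] := trm1_inhabited rho1.
have hv := @tight_polar_vec R A; have hu := @tight_polar_vec R B.
have p1 : \sum_z outcome (@polar_vec R A) (@polar_vec R B) rho z = 1.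
  by rewrite /outcome -Re_sum tight_trace// rho1.
have [[th [nth e]]|[w [h1 h2]]] := mixture_or_witness a0 b0 hv hu p1; last first.
  by exists (A * A * 'I_4)%type, (B * B * 'I_4)%type, (@polar_vec R A), (@polar_vec R B), w.
exfalso; apply: nsep; apply: (mixture_separable nth rho1) => i j.
apply/eqP; rewrite -subr_eq0; apply/eqP.
pose sig : bop R A B := fun i j =>
  \sum_k pvec (th k).1 (th k).2 i * conjc (pvec (th k).1 (th k).2 j).
apply: (@polar_vec_determine R A B (subm rho sig)) => x y.
rewrite qf_subm qf_sum.
under eq_bigr do rewrite (qf_pvec_real (@polar_vec R A) (@polar_vec R B) _ _ (x, y)).
rewrite -rmorph_sum -/(mprob _ _ _ _) e /outcome /= RRe_real ?subrr//.
by apply: ger0_real; exact: prho.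
Qed.

End EntanglementWitness.

(** * Tilted product measurements *)

Section PositiveCost.
Variable R : realType.
Local Notation C := R[i].
Local Notation mat := (mat R).

(** The bound on the mean in homogeneous form, applicable to the unnormalised vectors that remain
    after a copy has been measured. *)
Definition tilt_bounded (A B X Y : finType) (v : X -> A -> C) (u : Y -> B -> C)
    (g : X * Y -> R) :=
  forall a b, \sum_z g z * pprob v u a b z <= nrm a * nrm b.

Lemma outcome_ge0 (A B X Y : finType) (v : X -> A -> C) (u : Y -> B -> C)
  (rho : bop R A B) z : psd rho -> 0 <= outcome v u rho z.
Proof.
by move=> /(_ (pvec (v z.1) (u z.2))); rewrite lecE => /andP[_].
Qed.

Lemma outcome_qf (A B X Y : finType) (v : X -> A -> C) (u : Y -> B -> C)
  (rho : bop R A B) z : psd rho ->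
  qf rho (pvec (v z.1) (u z.2)) = (outcome v u rho z)%:C.
Proof. by move=> prho; rewrite RRe_real//; apply: ger0_real; exact: prho. Qed.

Lemma outcome_sum (A B X Y : finType) (v : X -> A -> C) (u : Y -> B -> C)
  (rho : bop R A B) : tight v -> tight u -> trm rho = 1 ->
  \sum_z outcome v u rho z = 1.
Proof. by move=> hv hu h; rewrite -Re_sum tight_trace// h. Qed.

(* The tilt is [g = 1 + eps * w] for the witness [w] and a small [eps]. *)
Lemma entangled_tilt (A B : finType) (rho : bop R A B) : entangled rho ->
  exists (X Y : finType) (v : X -> A -> C) (u : Y -> B -> C) (g : X * Y -> R),
    [/\ tight v, tight u, forall z, 0 < g z, tilt_bounded v u g &
        \sum_z outcome v u rho z / g z < 1].
Proof.
move=> ent; have [[prho rho1] _] := ent.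
have [X [Y [v [u [w [hv hu wle wgt]]]]]] := entangled_witness ent.
set p := outcome v u rho in wgt.
have p0 z : 0 <= p z by exact: outcome_ge0.
have p1 : \sum_z p z = 1 by exact: outcome_sum.
set d := \sum_z _ in wgt.
pose W := 1 + \sum_z `|w z|.
have W1 : 1 <= W by rewrite lerDl sumr_ge0.
have wW z : `|w z| <= W.
  by rewrite /W (bigD1 z) //= addrCA lerDl addr_ge0// sumr_ge0.
have dW : d <= W.
  rewrite -[W]mulr1 -p1 mulr_sumr; apply: ler_sum => z _.
  by rewrite ler_wpM2r// (le_trans (ler_norm _)).
have W0 : 0 < W by lra.
(* Chosen so that |eps w| <= 1/4 and so that the second-order loss 2 (eps W)^2 is half of the
   first-order gain eps d. *)
pose e := d / (4 * W ^+ 2).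
have e0 : 0 < e by rewrite divr_gt0// mulr_gt0// exprn_gt0.
have eW : e * (4 * W ^+ 2) = d by rewrite divfK// mulf_neq0// ?expf_neq0// gt_eqF.
have eW1 : e * W <= 4^-1.
  have : e * W * (4 * W) <= 1 * W by rewrite (_ : _ * _ = d) ?mul1r// -eW; ring.
  by rewrite mulrA ler_pM2r//; lra.
have small z : - 4^-1 <= e * w z <= 4^-1.
  rewrite -ler_norml normrM gtr0_norm// (le_trans _ eW1)// ler_wpM2l// ltW//.
exists X, Y, v, u, (fun z => 1 + e * w z); split => //.
- by move=> z; have := small z; lra.
- move=> a b; under eq_bigr do rewrite mulrDl mul1r -mulrA.
  rewrite big_split /= pprob_sum// -mulr_sumr gerDl.
  by rewrite pmulr_rle0.
(* The pointwise estimate is 1 / (1 + y) <= 1 - y + 2 y^2, valid for |y| <= 1/4. *)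
- apply: (@le_lt_trans _ _ (\sum_z (p z - e * (w z * p z) + 2 * (e * W) ^+ 2 * p z))).
    apply: ler_sum => z _; have hs := small z; rewrite ler_pdivrMr; last by lra.
    have h2 : (e * w z) ^+ 2 <= (e * W) ^+ 2.
      have h1 : `|e * w z| <= e * W by rewrite normrM gtr0_norm// ler_pM2l.
      rewrite -(real_normK (num_real (e * w z))) lerXn2r ?nnegrE//.
      by rewrite mulr_ge0 ?ltW.
    have h3 : 1 <= (1 - e * w z + 2 * (e * W) ^+ 2) * (1 + e * w z).
      set y := e * w z in h2 hs *; set q := (e * W) ^+ 2 in h2 *.
      have := sqr_ge0 y; nra.
    have := ler_wpM2l (p0 z) h3; rewrite mulr1 => /le_trans; apply.
    rewrite le_eqVlt; apply/orP; left; apply/eqP; ring.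
  rewrite big_split sumrB /= -!mulr_sumr p1 -/d mulr1.
  have -> : 2 * (e * W) ^+ 2 = e * d / 2 by rewrite -eW; field.
  have := mulr_gt0 e0 wgt; lra.
Qed.

Definition fcons (m : nat) (T : finType) (p : T * {ffun 'I_m -> T}) : {ffun 'I_m.+1 -> T} :=
  [ffun i => oapp p.2 p.1 (unlift ord0 i)].

Lemma fcons0 m (T : finType) (p : T * {ffun 'I_m -> T}) : fcons p ord0 = p.1.
Proof. by rewrite ffunE unlift_none. Qed.

Lemma fconsS m (T : finType) (p : T * {ffun 'I_m -> T}) i : fcons p (lift ord0 i) = p.2 i.
Proof. by rewrite ffunE liftK. Qed.

Lemma sum_fcons (V : nmodType) m (T : finType) (F : {ffun 'I_m.+1 -> T} -> V) :
  \sum_f F f = \sum_t \sum_f F (fcons (t, f)).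
Proof.
rewrite (reindex (@fcons m T)) /=; first by rewrite sum_pair.
apply: onW_bij.
exists (fun f : {ffun 'I_m.+1 -> T} => (f ord0, [ffun i : 'I_m => f (lift ord0 i)])) => [[t f]|f].
  by rewrite fcons0; congr (_, _); apply/ffunP => i; rewrite ffunE fconsS.
apply/ffunP => i; case: (unliftP ord0 i) => [j|] ->; first by rewrite fconsS ffunE.
by rewrite fcons0.
Qed.

Definition tvec (m : nat) (X A : finType) (v : X -> A -> C)
  (x : {ffun 'I_m -> X}) (a : {ffun 'I_m -> A}) : C := \prod_k v (x k) (a k).

Definition ttilt (m : nat) (X Y : finType) (g : X * Y -> R)
  (z : {ffun 'I_m -> X} * {ffun 'I_m -> Y}) : R := \prod_k g (z.1 k, z.2 k).

Lemma tight_tvec m (X A : finType) (v : X -> A -> C) : tight v -> tight (@tvec m X A v).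
Proof.
move=> hv a a'; rewrite /tvec.
under eq_bigr do rewrite rmorph_prod -big_split /=.
rewrite -(bigA_distr_bigA (fun k x => v x (a k) * conjc (v x (a' k)))) /=.
by under eq_bigr do rewrite hv; rewrite prod_delta.
Qed.

(** Contracting the first copy leaves a vector on the remaining ones; the inner conjugation undoes
    the one built into [amp]. *)
Lemma amp_fcons m (X A : finType) (v : X -> A -> C) x0 x a :
  amp (@tvec m.+1 X A v) (fcons (x0, x)) a =
  amp (@tvec m X A v) x (fun f => conjc (amp v x0 (fun i => a (fcons (i, f))))).
Proof.
rewrite {1}/amp sum_fcons exchange_big; apply: eq_bigr => f _ /=.
rewrite conjcK /amp mulr_suml; apply: eq_bigr => i _.
rewrite /tvec big_ord_recl !fcons0 /= mulrA; congr (_ * _).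
by apply: eq_bigr => k _; rewrite !fconsS.
Qed.

(* The tilt is bounded on product vectors and non-negative, so the copies can
   be contracted one at a time: after measuring one copy of a product vector
   the rest is still a product vector. *)
Lemma tilt_bounded_tensor m (A B X Y : finType) (v : X -> A -> C) (u : Y -> B -> C)
    (g : X * Y -> R) : (forall z, 0 <= g z) -> tilt_bounded v u g ->
  tilt_bounded (@tvec m X A v) (@tvec m Y B u) (@ttilt m X Y g).
Proof.
move=> g0 hg; elim: m => [|m IH] a b.
  rewrite sum_pair (eq_bigr (fun x => \sum_(y : {ffun 'I_0 -> Y}) nrm a * nrm b)) => [|x _].
    by rewrite !sum_ffun0.
  have e (T U : finType) (c : {ffun 'I_0 -> U} -> C) (s : T -> U -> C) z :
      sqn (amp (@tvec 0 T U s) z c) = nrm c.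
    have /card_gt0P[f0 _] : (0 < #|{ffun 'I_0 -> U}|)%N by rewrite card_ffun0.
    have all0 (f : {ffun 'I_0 -> U}) : f = f0 by apply/ffunP => -[].
    rewrite /amp /nrm (eq_bigr (fun=> conjc (c f0))) => [|f _].
      by rewrite sum_ffun0 (eq_bigr (fun=> sqn (c f0))) ?sum_ffun0 ?sqnJ// => f _; rewrite (all0 f).
    by rewrite /tvec big_ord0 mulr1 (all0 f).
  by apply: eq_bigr => y _; rewrite /ttilt big_ord0 mul1r /pprob !e.
rewrite sum_pair sum_fcons.
under eq_bigr do under eq_bigr do rewrite sum_fcons.
pose ra x0 (f : {ffun 'I_m -> A}) := conjc (amp v x0 (fun i => a (fcons (i, f)))).
pose rb y0 (f : {ffun 'I_m -> B}) := conjc (amp u y0 (fun i => b (fcons (i, f)))).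
have split_sum : \sum_x0 \sum_x \sum_y0 \sum_y ttilt g (fcons (x0, x), fcons (y0, y)) *
    pprob (tvec v) (tvec u) a b (fcons (x0, x), fcons (y0, y)) =
  \sum_x0 \sum_y0 g (x0, y0) * \sum_z @ttilt m X Y g z * pprob (tvec v) (tvec u) (ra x0) (rb y0) z.
  apply: eq_bigr => x0 _; rewrite exchange_big; apply: eq_bigr => y0 _ /=.
  rewrite sum_pair mulr_sumr; apply: eq_bigr => x _; rewrite mulr_sumr.
  apply: eq_bigr => y _; rewrite /pprob /= !amp_fcons [RHS]mulrA; congr (_ * _).
  rewrite /ttilt big_ord_recl /= !fcons0; congr (_ * _).
  by apply: eq_bigr => k _; rewrite !fconsS.
rewrite split_sum.
apply: (@le_trans _ _ (\sum_x0 \sum_y0 g (x0, y0) * (nrm (ra x0) * nrm (rb y0)))).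
  by apply: ler_sum => x0 _; apply: ler_sum => y0 _; rewrite ler_wpM2l// IH.
(* Unfolding the norms of the contracted vectors exchanges the roles: the last [m] coordinates are
   now fixed on each side, and the one-copy bound applies to every pair of slices. *)
have -> : \sum_x0 \sum_y0 g (x0, y0) * (nrm (ra x0) * nrm (rb y0)) =
   \sum_f \sum_h \sum_z g z *
     pprob v u (fun i => a (fcons (i, f))) (fun i => b (fcons (i, h))) z.
  under [RHS]eq_bigr do rewrite exchange_big.
  rewrite [RHS]exchange_big sum_pair; apply: eq_bigr => x0 _; apply: eq_bigr => y0 _.
  rewrite /nrm mulr_suml mulr_sumr; apply: eq_bigr => f _.
  rewrite !mulr_sumr; apply: eq_bigr => h _.
  by rewrite /ra /rb !sqnJ.
have nf (T : finType) (c : {ffun 'I_m.+1 -> T} -> C) :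
    nrm c = \sum_f nrm (fun i => c (fcons (i, f))).
  by rewrite /nrm sum_fcons exchange_big.
rewrite (nf _ a) (nf _ b) mulr_suml; apply: ler_sum => f _; rewrite mulr_sumr.
by apply: ler_sum => h _; exact: hg.
Qed.
End PositiveCost.

(** * Positivity of the entanglement cost *)

Section HypothesisTest.
Variable R : realType.
Local Notation C := R[i].
Local Notation mat := (mat R).

Lemma tight_pvec (A B X Y : finType) (v : X -> A -> C) (u : Y -> B -> C) :
  tight v -> tight u -> tight (fun z : X * Y => pvec (v z.1) (u z.2)).
Proof.
move=> hv hu i j.
rewrite [X in _ = X](_ : _ = (i.1 == j.1)%:R * (i.2 == j.2)%:R); last first.
  by rewrite -natrM mulnb -xpair_eqE -!surjective_pairing.
rewrite -hv -hu mulr_suml sum_pair; apply: eq_bigr => x _; rewrite mulr_sumr.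
by apply: eq_bigr => y _; rewrite /pvec /= rmorphM /=; ring.
Qed.

(** Accepting a set of outcomes is an effect between 0 and 1, hence of numerical radius at most
    one. *)
Lemma tight_test_le_tnorm (T Z : finType) (V : Z -> T -> C) (S : pred Z) (M : mat T T) :
  tight V -> herm M ->
  Normc.normc (\sum_(z | S z) qf M (V z)) <= tnorm M.
Proof.
move=> hV hM; pose P : mat T T := fun i j => \sum_(z | S z) V z i * conjc (V z j).
have -> : \sum_(z | S z) qf M (V z) = trm (mulm P M).
  rewrite trm_mulm /qf /P exchange_big [RHS]exchange_big; apply: eq_bigr => i _ /=.
  rewrite exchange_big; apply: eq_bigr => j _ /=; rewrite mulr_suml.
  by apply: eq_bigr => z _; ring.
apply: le_tnorm => // w; rewrite -(tight_nrm w hV).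
have -> : qf P w = (\sum_(z | S z) sqn (amp V z w))%:C.
  rewrite qf_sum rmorph_sum; apply: eq_bigr => z _ /=; rewrite -mulcJ /amp.
  rewrite rmorph_sum mulr_suml; apply: eq_bigr => i _; rewrite mulr_sumr /=.
  by apply: eq_bigr => j _; rewrite rmorphM /= conjcK; ring.
rewrite normc_real ger0_norm; last by apply: sumr_ge0 => z _; exact: sqn_ge0.
rewrite [leRHS](bigID S) /= lerDl; apply: sumr_ge0 => z _; exact: sqn_ge0.
Qed.

Lemma qf_tpow (A B X Y : finType) (v : X -> A -> C) (u : Y -> B -> C)
    (rho : bop R A B) m z :
  qf (tpow rho m) (pvec (@tvec R m X A v z.1) (@tvec R m Y B u z.2))
  = \prod_(k < m) qf rho (pvec (v (z.1 k)) (u (z.2 k))).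
Proof.
rewrite /qf prod_sum_pair; apply: eq_bigr => i _.
rewrite prod_sum_pair; apply: eq_bigr => j _.
rewrite !big_split /=; congr (_ * _ * _); first rewrite -rmorph_prod;
  by rewrite /pvec big_split.
Qed.

Lemma outcome_tpow (A B X Y : finType) (v : X -> A -> C) (u : Y -> B -> C)
    (rho : bop R A B) m z : psd rho ->
  qf (tpow rho m) (pvec (@tvec R m X A v z.1) (@tvec R m Y B u z.2))
  = (\prod_(k < m) outcome v u rho (z.1 k, z.2 k))%:C.
Proof.
move=> prho; rewrite qf_tpow rmorph_prod; apply: eq_bigr => k _ /=.
exact: (outcome_qf v u (z.1 k, z.2 k) prho).
Qed.

Lemma qf_tpow_psi_plus n w :
  qf (tpow (@psi_plus R) n) w = ((2^-1) ^+ n * sqn (\sum_z w (z, z)))%:C.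
Proof.
rewrite rmorphM rmorphXn fmorphV rmorph_nat /= -mulJc -!sum_delta2 rmorph_sum /=.
rewrite mulr_suml mulr_sumr; apply: eq_bigr => i _.
rewrite !mulr_sumr; apply: eq_bigr => j _; rewrite tpow_psi_plus.
have -> : conjc (w i * (i.1 == i.2)%:R) = conjc (w i) * (i.1 == i.2)%:R.
  by rewrite -[X in _ = _ * X]conjc_nat; exact: rmorphM.
ring.
Qed.

(* A maximally entangled state of Schmidt rank [2 ^ n] gains at most a factor
   [2 ^ n] over product vectors, by Cauchy-Schwarz over its Schmidt terms. *)
Lemma LOCC_psi_plus_outcome n (A B X Y : finType) (v : X -> A -> C) (u : Y -> B -> C)
    (Lam : bop R {ffun 'I_n -> 'I_2} {ffun 'I_n -> 'I_2} -> bop R A B)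
    (S : pred (X * Y)) (c : R) : LOCC Lam ->
  (forall a b, \sum_(z | S z) pprob v u a b z <= c * (nrm a * nrm b)) ->
  Re (\sum_(z | S z) qf (Lam (tpow psi_plus n)) (pvec (v z.1) (u z.2))) <= c * 2 ^+ n.
Proof.
move=> /LOCC_sepkraus[s [hs hn]] hc.
have bound z : Re (qf (Lam (tpow psi_plus n)) (pvec (v z.1) (u z.2))) <=
    \sum_(p <- s) \sum_i pprob v u (p.1 ^~ i) (p.2 ^~ i) z.
  rewrite (eq_qf _ (hs _)) qf_sum Re_sum; apply: ler_sum => p _.
  rewrite qf_sandw qf_tpow_psi_plus /=.
  (* A product Kraus operator sends the Schmidt term |i i> to the product of its [i]-th columns. *)
  have e i : app (adjm (kron p.1 p.2)) (pvec (v z.1) (u z.2)) (i, i) =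
      amp v z.1 (p.1 ^~ i) * amp u z.2 (p.2 ^~ i).
    rewrite /app sum_pair /amp mulr_suml; apply: eq_bigr => a _; rewrite mulr_sumr.
    by apply: eq_bigr => b _; rewrite /adjm /kron /pvec rmorphM /=; ring.
  under eq_bigr do rewrite e.
  have := sqn_sum_le (fun i => amp v z.1 (p.1 ^~ i) * amp u z.2 (p.2 ^~ i)).
  rewrite card_ffun !card_ord natrX => h.
  rewrite exprVn mulrC ler_pdivrMr ?exprn_gt0// mulrC (le_trans h)//.
  by rewrite ler_pM2l ?exprn_gt0//; apply: ler_sum => i _; rewrite sqnM.
rewrite Re_sum.
apply: (@le_trans _ _ (\sum_(z | S z) \sum_(p <- s) \sum_i pprob v u (p.1 ^~ i) (p.2 ^~ i) z)).
  by apply: ler_sum => z _; exact: bound.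
rewrite exchange_big /=.
apply: (@le_trans _ _ (\sum_(p <- s) \sum_i c * (nrm (p.1 ^~ i) * nrm (p.2 ^~ i)))).
  by apply: ler_sum => p _; rewrite exchange_big; apply: ler_sum => i _; exact: hc.
under eq_bigr do rewrite -mulr_sumr.
rewrite -mulr_sumr exchange_big /=.
rewrite le_eqVlt; apply/orP; left; apply/eqP; congr (_ * _).
(* The images of each unit vector |i i> under the Kraus operators have total weight 1, and there are
   2 ^ n such vectors. *)
transitivity (\sum_(i : {ffun 'I_n -> 'I_2}) (1 : R)).
  apply: eq_bigr => i _; rewrite -(nrm_delta R (i, i)) -hn; apply: eq_bigr => p _.
  rewrite /nrm [RHS]sum_pair mulr_suml; apply: eq_bigr => a _; rewrite mulr_sumr.
  apply: eq_bigr => b _; rewrite -sqnM; congr sqn; rewrite /app.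
  by under eq_bigr do rewrite mulrC eq_sym; rewrite sum_delta.
by rewrite sumr_const card_ffun !card_ord natrX.
Qed.

(** The trace norm dominates the gap between the acceptance probabilities of the test [S]; Markov's
    inequality bounds the acceptance of the LOCC output and the rejection of [rho]. *)
Lemma LOCC_psi_plus_far (A B X Y : finType) (v : X -> A -> C) (u : Y -> B -> C)
    (g : X * Y -> R) (rho : bop R A B) (t : R) n m
    (Lam : bop R {ffun 'I_n -> 'I_2} {ffun 'I_n -> 'I_2} ->
       bop R {ffun 'I_m -> A} {ffun 'I_m -> B}) :
  is_state rho -> tight v -> tight u -> (forall z, 0 < g z) -> tilt_bounded v u g ->
  0 < t -> LOCC Lam ->
  1 - (t * \sum_z outcome v u rho z / g z) ^+ m - t ^- m * 2 ^+ n
  <= tnorm (subm (Lam (tpow psi_plus n)) (tpow rho m)).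
Proof.
move=> [prho rho1] hv hu g0 hg t0 hLam; have hrho := psd_herm prho.
pose S : pred ({ffun 'I_m -> X} * {ffun 'I_m -> Y}) := fun z => t ^+ m <= ttilt g z.
have hv' : tight (@tvec R m X A v) by exact: tight_tvec.
have hu' : tight (@tvec R m Y B u) by exact: tight_tvec.
have tm0 : 0 < t ^+ m by rewrite exprn_gt0.
have tt0 z : 0 < @ttilt R m X Y g z by exact: prodr_gt0.
have hpsi : Re (\sum_(z | S z) qf (Lam (tpow psi_plus n)) (pvec (tvec v z.1) (tvec u z.2)))
    <= t ^- m * 2 ^+ n.
  apply: LOCC_psi_plus_outcome => // a b.
  apply: (@le_trans _ _ (t ^- m * \sum_z ttilt g z * pprob (tvec v) (tvec u) a b z)).
    rewrite [X in _ * X](bigID S) /= mulrDr.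
    apply: (@le_trans _ _ (t ^- m * \sum_(z | S z) ttilt g z * pprob (tvec v) (tvec u) a b z)).
      rewrite mulr_sumr; apply: ler_sum => z Sz; rewrite mulrA ler_peMl ?pprob_ge0//.
      by rewrite mulrC ler_pdivlMr// mul1r.
    rewrite lerDl; apply: mulr_ge0; first by rewrite invr_ge0 ltW.
    apply: sumr_ge0 => z _.
    by rewrite mulr_ge0 ?pprob_ge0 ?ltW.
  rewrite ler_pM2l ?invr_gt0//.
  by apply: (@tilt_bounded_tensor R m A B X Y v u g) => // z; exact: ltW.
pose P (z : {ffun 'I_m -> X} * {ffun 'I_m -> Y}) : R :=
  \prod_(k < m) outcome v u rho (z.1 k, z.2 k).
have P0 z : 0 <= P z by apply: prodr_ge0 => k _; exact: outcome_ge0.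
have P1 : \sum_z P z = 1.
  by rewrite -(prod_sum_pair (fun (k : 'I_m) p => outcome v u rho p)) big1// => k _;
    rewrite outcome_sum.
(* On rejection t ^ m / ttilt g z exceeds 1, and its mean over independent copies is a product of
   one-copy means. *)
have hSc : \sum_(z | ~~ S z) P z <= (t * \sum_z outcome v u rho z / g z) ^+ m.
  apply: (@le_trans _ _ (\sum_z t ^+ m * (P z / ttilt g z))); last first.
    rewrite -mulr_sumr exprMn ler_pM2l// le_eqVlt; apply/orP; left; apply/eqP.
    rewrite -[m in RHS]card_ord -prodr_const (prod_sum_pair (fun _ p => outcome v u rho p / g p)).
    by apply: eq_bigr => z _; rewrite big_split prodfV.
  rewrite [leRHS](bigID S) /= -[leLHS]add0r lerD//.
    apply: sumr_ge0 => z _; apply: mulr_ge0; first exact: ltW.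
    by apply: divr_ge0 => //; exact: ltW.
  apply: ler_sum => z; rewrite -ltNge => h.
  by rewrite mulrCA ler_peMr// ler_pdivlMr// mul1r ltW.
have hS : Re (\sum_(z | S z) qf (tpow rho m) (pvec (tvec v z.1) (tvec u z.2))) =
    1 - \sum_(z | ~~ S z) P z.
  rewrite -P1 [in RHS](bigID S) /= addrK Re_sum; apply: eq_bigr => z _.
  by rewrite outcome_tpow.
have hX : herm (subm (Lam (tpow psi_plus n)) (tpow rho m)).
  apply: herm_subm; last exact: herm_tpow.
  by apply: LOCC_herm => //; apply: herm_tpow; exact: herm_psi_plus.
have := tight_test_le_tnorm S (tight_pvec hv' hu') hX.
set Q := \sum_(z | S z) _ => h.
have hQ : Q = \sum_(z | S z) qf (Lam (tpow psi_plus n)) (pvec (tvec v z.1) (tvec u z.2))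
   - \sum_(z | S z) qf (tpow rho m) (pvec (tvec v z.1) (tvec u z.2)).
  by rewrite /Q -sumrB; apply: eq_bigr => z _; rewrite qf_subm.
have h3 : - Re Q <= tnorm (subm (Lam (tpow psi_plus n)) (tpow rho m)).
  by rewrite (le_trans _ h)// (le_trans _ (Re_le_normc _))// -normrN ler_norm.
move: h3; rewrite hQ ReD ReN hS; lra.
Qed.

Lemma expr_lt_eventually (q e : R) : 0 <= q < 1 -> 0 < e ->
  \forall n \near \oo, q ^+ n < e.
Proof.
move=> /andP[q0 q1] e0.
have h : (GRing.exp q) @ \oo --> (0 : R) by apply: cvg_expr; rewrite ger0_norm.
exact: (cvgr_lt _ h).
Qed.

(** The bound is any [l] with t ^ l >= 4. A rate above [l] eventually gives m >= l n, hence t ^ -m 2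
    ^ n <= 2 ^ -n, and the distance stays above 1/2 instead of tending to 0. *)
Lemma rate_psi_plus_lty (A B : finType) (rho : bop R A B) :
  entangled rho -> (rate psi_plus rho < +oo)%E.
Proof.
move=> ent; have [st _] := ent; have [prho rho1] := st.
have [X [Y [v [u [g [hv hu g0 hg a1]]]]]] := entangled_tilt ent.
move: a1; set a := \sum_z _ => a1.
have a0 : 0 <= a by apply: sumr_ge0 => z _; rewrite divr_ge0 ?outcome_ge0// ltW.
(* Lies strictly between 1 and 1 / a, and remains meaningful when a = 0. *)
pose t := 2 / (1 + a).
have t1 : 1 < t by rewrite ltr_pdivlMr; lra.
have t0 : 0 < t by lra.
have ta0 : 0 <= t * a by rewrite mulr_ge0// ltW.
have ta1 : t * a < 1 by rewrite /t mulrAC ltr_pdivrMr; lra.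
have [l l0 tl] : exists2 l, (0 < l)%N & 4 <= t ^+ l.
  have h : \forall n \near \oo, t^-1 ^+ n < 4^-1.
    apply: expr_lt_eventually; last by lra.
    by rewrite invr_ge0 ltW//= invf_lt1.
  have [l [/= h1 h2]] : exists l, t^-1 ^+ l < 4^-1 /\ (0 < l)%N.
    have : \forall n \near \oo, t^-1 ^+ n < 4^-1 /\ (0 < n)%N.
      by apply: filterI => //; exact: nbhs_infty_gt.
    by case=> N _ /(_ N (leqnn N)); exists N.
  exists l => //; move: h1; rewrite exprVn ltf_pV2 ?posrE ?exprn_gt0//.
  exact: ltW.
apply: (@le_lt_trans _ _ l%:R%:E); last exact: ltry.
apply: ge_ereal_sup => _ [r [r0 [m [Lam [hLam [mr tn]]]]] <-].
rewrite lee_fin leNgt; apply/negP => lr.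
have e1 : \forall n \near \oo, l%:R < (m n)%:R / n%:R :> R by exact: (cvgr_gt _ mr).
have e2 : \forall n \near \oo,
    tnorm (subm (Lam n (tpow psi_plus n)) (tpow rho (m n))) < 4^-1.
  by apply: (cvgr_lt _ tn); lra.
have e3 : \forall n \near \oo, (t * a) ^+ n < 4^-1.
  by apply: expr_lt_eventually; rewrite ?ta0 ?ta1//; lra.
have e4 : \forall n \near \oo, (2^-1 : R) ^+ n < 4^-1.
  by apply: expr_lt_eventually; lra.
suff : \forall n \near \oo, False.
  by case=> N _ /(_ N (leqnn N)).
near=> n.
have n0 : (0 < n)%N by near: n; exact: nbhs_infty_gt.
have mn : (l * n <= m n)%N.
  have : l%:R < (m n)%:R / n%:R :> R by near: n.
  by rewrite ltr_pdivlMr ?ltr0n// -natrM ltr_nat => /ltnW.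
have nm : (n <= m n)%N by rewrite (leq_trans _ mn)// leq_pmull.
have h2 : tnorm (subm (Lam n (tpow psi_plus n)) (tpow rho (m n))) < 4^-1 by near: n.
have h3 : (t * a) ^+ n < 4^-1 by near: n.
have h4 : (2^-1 : R) ^+ n < 4^-1 by near: n.
have := LOCC_psi_plus_far st hv hu g0 hg t0 (hLam n); rewrite -/a.
have h5 : (t * a) ^+ (m n) <= (t * a) ^+ n by rewrite ler_wiXn2l// ltW.
have h6 : t ^- m n * 2 ^+ n <= (2^-1) ^+ n.
  rewrite mulrC ler_pdivrMr ?exprn_gt0//.
  apply: (@le_trans _ _ (2^-1 ^+ n * t ^+ (l * n))).
    rewrite exprM -exprMn; apply: lerXn2r; rewrite ?nnegrE//; lra.
  rewrite ler_pM2l ?exprn_gt0 ?invr_gt0//; apply: ler_weXn2l => //; exact: ltW.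
lra.
Unshelve. all: by end_near. Qed.

End HypothesisTest.

(** * Combining the inequalities between rates *)

Local Open Scope ereal_scope.

Theorem theorem2 (R : realType) (A B : finType) (rho : bop R A B) :
  entangled rho ->
  [/\ E_D rho / E_c rho <= sym_ent rho,
      sym_ent rho <= 1,
      asym_ent rho <= E_b rho / E_c rho
    & 0 < asym_ent rho -> E_D rho < E_c rho].
Proof.
move=> ent; have [st _] := ent; have [prho rho1] := st.
have hrho := psd_herm prho; have hpsi := @herm_psi_plus R.
have psi1 := @trm_psi_plus R.
have r_gt0 := rate_psi_plus_gt0 st; have r_lty := rate_psi_plus_lty ent.
have D_ge0 : 0 <= E_D rho by exact: rate_ge0.
have S_ge0 : 0 <= sym_ent rho by exact: rate_ge0.
have DS : E_D rho * rate psi_plus rho <= sym_ent rho.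
  rewrite -(rate_psi_plus_swap hrho); apply: rate_trans => //.
  exact: herm_swapop.
have rS : rate psi_plus rho * sym_ent rho <= rate psi_plus rho.
  rewrite -{2}(rate_psi_plus_swap hrho); apply: rate_trans => //.
  exact: herm_swapop.
rewrite /asym_ent /E_b /E_c.
move: r_gt0 r_lty DS rS; case: (rate psi_plus rho) => [r| |] // r_gt0 _ DS rS.
rewrite lte_fin in r_gt0.
have -> : (r%:E)^-1 = (r^-1)%:E by rewrite inver gt_eqF.
rewrite inver invr_eq0 gt_eqF// invrK.
(* With 0 < r < +oo, [rS] excludes an infinite symmetry, and [DS] then excludes an infinite
   distillable entanglement; only the finite case carries content. *)
move: D_ge0 S_ge0 DS rS; case: (E_D rho) => [d| |] //; case: (sym_ent rho) => [s| |] //.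
- rewrite !lee_fin => d0 s0 ds rs.
  have s1 : (s <= 1)%R by rewrite -(ler_pM2l r_gt0) mulr1.
  have e : ((r^-1 - d) * r = 1 - d * r)%R by rewrite mulrBl mulVf// gt_eqF.
  split => //.
  + by rewrite e lerB.
  + rewrite !lte_fin => h.
    rewrite -(ltr_pM2r r_gt0) mulVf ?gt_eqF//; lra.
- by move=> _ _ _; rewrite gt0_muley// leye_eq.
- by move=> _ _; rewrite gt0_mulye.
- by move=> _ _ _; rewrite gt0_muley// leye_eq.
Qed.
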